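(* Let $\hat\sigma^2=\frac1d\|Y-\hat\theta\|_2^2$ with $\hat\theta$ the sorted-$\ell_1$ estimator. (1) Let $\tau>0,a>0$. There exist constants $c,C>0$ and $\gamma\in(0,1/2]$ depending only on $(a,\tau)$ such that for all integers $s,d$ with $1\le s<\lfloor\gamma d\rfloor/4$, with $\lambda_j=c\log^{1/a}(ed/j)$ and $\tilde\sigma$ built with this $\gamma$, $$\sup_{P_\xi\in\mathcal G_{a,\tau}}\sup_{\sigma>0}\sup_{\theta\in\Theta_s}\mathbf E_{\theta,P_\xi,\sigma}|\hat\sigma^2-\sigma^2|\le C\sigma^2\max\Big(\frac1{\sqrt d},\frac sd\log^{2/a}\Big(\frac{ed}s\Big)\Big).$$ (2) Let $\tau>0,a>4$. There exist constants $c,C>0$ and $\gamma\in(0,1/2]$ depending only on $(a,\tau)$ such that for all integers $s,d$ with $1\le s<\lfloor\gamma d\rfloor/4$, with $\lambda_j=c(d/j)^{1/a}$ and $\tilde\sigma$ built with this $\gamma$, $$\sup_{P_\xi\in\mathcal P_{a,\tau}}\sup_{\sigma>0}\sup_{\theta\in\Theta_s}\mathbf E_{\theta,P_\xi,\sigma}|\hat\sigma^2-\sigma^2|\le C\sigma^2\max\Big(\frac1{\sqrt d},\Big(\frac sd\Big)^{1-\frac2a}\Big).$$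
   Context: Model: $Y_i=\theta_i+\sigma\xi_i$, $i=1,\dots,d$, $\theta\in\mathbb R^d$, $\sigma>0$, $\xi_i$ i.i.d. with distribution $P_\xi$, $\mathbf E\xi_1=0,\mathbf E\xi_1^2=1$; $\mathbf E_{\theta,P_\xi,\sigma}$ expectation; $\Theta_s=\{\theta:\|\theta\|_0\le s\}$. $\mathcal G_{a,\tau}$ ($a,\tau>0$): distributions with $\mathbf E\xi_1=0,\mathbf E\xi_1^2=1$, $\mathbf P(|\xi_1|>t)\le2e^{-(t/\tau)^a}$ for all $t\ge2$; $\mathcal P_{a,\tau}$ ($\tau>0,a\ge2$): such distributions with $\mathbf P(|\xi_1|>t)\le(\tau/t)^a$ for all $t\ge2$. Median-of-means: given $\gamma\in(0,1/2]$, $m=\lfloor\gamma d\rfloor$, disjoint blocks $B_1,\dots,B_m$ partitioning $\{1,\dots,d\}$ each of size $\ge\lfloor d/m\rfloor$, $\bar\sigma_i^2=|B_i|^{-1}\sum_{j\in B_i}Y_j^2$, $\tilde\sigma^2=\mathrm{med}(\bar\sigma_i^2)$, $\tilde\sigma=\sqrt{\tilde\sigma^2}$. Sorted-$\ell_1$ estimator: for $\lambda_1\ge\dots\ge\lambda_d>0$, $\|\theta\|_*=\sum_i\lambda_i|\theta|_{(d-i+1)}$ ($|\theta|_{(1)}\le\dots\le|\theta|_{(d)}$ order statistics of $|\theta_i|$), $\hat\theta\in\arg\min_\theta\big(\sum_i(Y_i-\theta_i)^2+\tilde\sigma\|\theta\|_*\big)$. *)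

(* Defs.v *)
From HB Require Import structures.
From mathcomp Require Import all_boot all_order all_algebra.
From mathcomp Require Import all_classical all_reals all_analysis.
Set Implicit Arguments. Unset Strict Implicit. Unset Printing Implicit Defensive.
Import Order.TTheory GRing.Theory Num.Theory.
Import numFieldNormedType.Exports.
Local Open Scope classical_set_scope.
Local Open Scope ring_scope.

(* Sorted-l1 norm: sum_i lam_i |th|_(d-i+1), i.e. lam 1 multiplies the largest
   absolute entry.  [lam] is indexed from 1. *)
Definition sorted_l1 (R : realType) (d : nat) (lam : nat -> R) (th : 'I_d -> R) : R :=
  let s := sort (fun x y : R => y <= x) [seq `|th i| | i <- enum 'I_d] in
  \sum_(i < d) lam i.+1 * nth 0 s i.

Definition is_sorted_l1_est (R : realType) (d : nat) (lam : nat -> R) (sig : R)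
    (y th : 'I_d -> R) : Prop :=
  forall th' : 'I_d -> R,
    \sum_(i < d) (y i - th i) ^+ 2 + sig * sorted_l1 lam th
      <= \sum_(i < d) (y i - th' i) ^+ 2 + sig * sorted_l1 lam th'.

Definition nblocks (R : realType) (gam : R) (d : nat) : nat := Num.truncn (gam * d%:R).

Definition is_block_partition (d m : nat) (B : 'I_m -> {set 'I_d}) : Prop :=
  (forall i j, i != j -> (B i :&: B j = finset.set0)) /\
  (forall k : 'I_d, exists i, k \in B i) /\
  (forall i, (d %/ m <= #|B i|)%N).

(* median of m reals (lower median for even m) *)
Definition median (R : realType) (m : nat) (x : 'I_m -> R) : R :=
  nth 0 (sort <=%R [seq x i | i <- enum 'I_m]) (m.-1 %/ 2).

Definition mom_sigma (R : realType) (d m : nat) (B : 'I_m -> {set 'I_d})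
    (y : 'I_d -> R) : R :=
  Num.sqrt (median (fun i => (#|B i|%:R)^-1 * \sum_(j in B i) y j ^+ 2)).

Definition sigma_hat2 (R : realType) (d : nat) (y th : 'I_d -> R) : R :=
  (d%:R)^-1 * \sum_(i < d) (y i - th i) ^+ 2.

Definition in_Theta (R : realType) (d s : nat) (th : 'I_d -> R) : Prop :=
  (#|[set i | th i != 0%R]| <= s)%N.

Definition class_G (R : realType) (a tau : R) (mu : probability R R) : Prop :=
  (\int[mu]_x x%:E = 0)%E /\ (\int[mu]_x (x ^+ 2)%:E = 1)%E /\
  (forall t : R, 2 <= t -> (mu [set x : R | (t < `|x|)%R] <= (2 * expR (- ((t / tau) `^ a)))%:E)%E).

Definition class_P (R : realType) (a tau : R) (mu : probability R R) : Prop :=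
  2 <= a /\
  (\int[mu]_x x%:E = 0)%E /\ (\int[mu]_x (x ^+ 2)%:E = 1)%E /\
  (forall t : R, 2 <= t -> (mu [set x : R | (t < `|x|)%R] <= ((tau / t) `^ a)%:E)%E).

Definition iid_with (R : realType) (d0 : measure_display) (Omega : measurableType d0)
    (P : probability Omega R) (d : nat) (xi : 'I_d -> Omega -> R)
    (mu : probability R R) : Prop :=
  (forall i, measurable_fun setT (xi i)) /\
  (forall i (A : set R), measurable A -> P (xi i @^-1` A) = mu A) /\
  (forall A : 'I_d -> set R, (forall i, measurable (A i)) ->
     P (\bigcap_(i in [set: 'I_d]) (xi i @^-1` A i)) =
     (\prod_(i < d) P (xi i @^-1` A i))%E).

Definition obs (R : realType) (T : Type) (d : nat) (theta : 'I_d -> R) (sigma : R)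
    (xi : 'I_d -> T -> R) (w : T) : 'I_d -> R :=
  fun i => theta i + sigma * xi i w.

(* Main.v *)
(* With u := thetahat - theta, first-order optimality of the estimator along the
   segment towards theta gives
     2 |u|^2 <= 2 sigma <xi, u> + sigmatilde (|theta|_* - |thetahat|_* ).
   Sort the coordinates by (|theta_i|, |xi_i|) lexicographically, in decreasing order:
   the support of theta comes first and the noise is sorted off the support.  By the
   rearrangement inequality the penalty difference is at most
   sum_k eps_k lambda_k |u_k| with eps_k = 1 for k <= s and -1 afterwards, so off the first
   2s coordinates the penalty absorbs the noise wherever |xi_k| <= lambda_k / 8, and
   Young's inequality bounds | |u|^2 - 2 sigma <xi, u> | by the noise energy on the first
   2s coordinates, the energy of the exceptional coordinates, and sigmatilde^2 times
   sum_(k <= s) lambda_k^2.  The exceptional coordinates are controlled through moments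
   of excesses: the r-th largest |xi_i| exceeds t only if some product of r excesses over
   level t is large, and binomial(d, r) g(t)^r <= 2^-r for the chosen weights.  Finally
   sigmatilde^2 <= 8 sigma^2 mean(xi_i^2) always, since most blocks avoid the support,
   and sigmatilde < sigma / 2 has probability O(1/d) by a Chernoff bound and a union
   bound over sets of blocks.  The estimator is not assumed measurable, so the loss is
   bounded pointwise by measurable functions of the noise. *)
Require Import Defs.
From HB Require Import structures.
From mathcomp Require Import all_boot all_order all_algebra.
From mathcomp Require Import all_classical all_reals all_analysis.
From mathcomp Require Import measurable_realfun ring lra zify.
Set Implicit Arguments. Unset Strict Implicit. Unset Printing Implicit Defensive.
Import Order.TTheory GRing.Theory Num.Theory.
Import numFieldNormedType.Exports.
Local Open Scope classical_set_scope.
Local Open Scope ring_scope.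

(** * Rearrangement inequality, and the sorted norm as a maximum over orderings *)

(** List form of the weighted sum, suited to induction on the list. Its weights start at index 0,
    those of [sorted_l1] at index 1, whence [lam \o succn] later. *)
Definition wsum {R : realType} (lam : nat -> R) (l : seq R) : R :=
  \sum_(i < size l) lam i * nth 0 l i.

Lemma wsum_cons {R : realType} (lam : nat -> R) x l :
  wsum lam (x :: l) = lam 0 * x + wsum (lam \o succn) l.
Proof. by rewrite /wsum big_ord_recl. Qed.

(** On its way to the front [y] passes entries that do not exceed it, one at a time, and each time
    trades its weight for one at least as large. *)
Lemma wsum_move_front {R : realType} (lam : nat -> R) y a b :
  (forall i j, (i <= j)%N -> (j < size (a ++ y :: b))%N -> lam j <= lam i) ->
  {in a, forall x, x <= y} ->
  wsum lam (a ++ y :: b) <= wsum lam (y :: a ++ b).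
Proof.
elim: a lam => [|x a IH] lam hlam ha //=.
rewrite !wsum_cons.
have : wsum (lam \o succn) (a ++ y :: b) <= wsum (lam \o succn) (y :: a ++ b).
  apply: IH => [i j ij jl|z za]; first exact: hlam.
  by apply: ha; rewrite inE za orbT.
rewrite !wsum_cons /=.
have h01 : lam 1%N <= lam 0%N.
  by apply: hlam; rewrite //= size_cat /= addnS.
have hxy : x <= y by apply: ha; rewrite mem_head.
(* What remains is (lam 0 - lam 1) (y - x) >= 0. *)
nra.
Qed.

(** Selection sort: the head of the sorted list is a maximum, so bringing it to the front does not
    lower the sum; the tails are compared by induction. *)
Lemma wsum_sorted_max {R : realType} (lam : nat -> R) l l' :
  (forall i j, (i <= j)%N -> (j < size l)%N -> lam j <= lam i) ->
  perm_eq l l' -> sorted (fun x y => y <= x) l' ->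
  wsum lam l <= wsum lam l'.
Proof.
elim: l' lam l => [|y l' IH] lam l hlam pl sl.
  by move: pl => /perm_nilP ->.
have yl : y \in l by rewrite (perm_mem pl) mem_head.
move: hlam pl; case/splitPr: yl => a b hlam pl.
have pl' : perm_eq (a ++ b) l'.
  by rewrite -(perm_cons y); apply: perm_trans pl; rewrite perm_sym perm_catC /= perm_cons perm_catC.
have ymax : {in l', forall x, x <= y}.
  move: sl; rewrite /= path_sortedE; last by move=> u v w /= h1 h2; apply: le_trans h2 h1.
  by case/andP => /allP.
apply: (@le_trans _ _ (wsum lam (y :: a ++ b))).
  apply: wsum_move_front => // x xa; apply: ymax.
  by rewrite -(perm_mem pl') mem_cat xa.
rewrite !wsum_cons lerD2l; apply: IH => //.
  move=> i j ij jl; apply: hlam => //.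
  by move: jl; rewrite !size_cat /= addnS.
exact: path_sorted sl.
Qed.

Lemma perm_map_inj {T : eqType} {d : nat} (v : 'I_d -> T) (p : 'I_d -> 'I_d) :
  injective p -> perm_eq [seq v (p k) | k <- enum 'I_d] [seq v i | i <- enum 'I_d].
Proof.
move=> pinj; rewrite (map_comp v p); apply: perm_map.
apply: uniq_perm; [by rewrite (map_inj_uniq pinj) enum_uniq|exact: enum_uniq|move=> x].
rewrite mem_enum; apply/mapP.
by have [q qp pq] := injF_bij pinj; exists (q x); rewrite ?mem_enum // pq.
Qed.

Lemma wsum_enum {R : realType} (lam : nat -> R) d (v : 'I_d -> R) :
  wsum lam [seq v i | i <- enum 'I_d] = \sum_(i < d) lam i * v i.
Proof.
rewrite /wsum size_map size_enum_ord; apply: eq_bigr => i _.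
by rewrite (nth_map i) ?size_enum_ord // nth_ord_enum.
Qed.

Lemma sorted_l1_wsum {R : realType} d (lam : nat -> R) (v : 'I_d -> R) :
  sorted_l1 lam v = wsum (lam \o succn)
    (sort (fun x y : R => y <= x) [seq `|v i| | i <- enum 'I_d]).
Proof. by rewrite /wsum size_sort size_map size_enum_ord. Qed.

(** Together with equality along a decreasing order, this makes the sorted norm a maximum over
    orderings. It allows the norm of one vector to be bounded below along an order chosen for
    another. *)
Lemma sorted_l1_ge {R : realType} d (lam : nat -> R) (v : 'I_d -> R) (p : 'I_d -> 'I_d) :
  (forall i j, (0 < i)%N -> (i <= j <= d)%N -> lam j <= lam i) -> injective p ->
  \sum_(k < d) lam k.+1 * `|v (p k)| <= sorted_l1 lam v.
Proof.
move=> hlam pinj; rewrite sorted_l1_wsum.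
rewrite -(wsum_enum (lam \o succn) (fun k => `|v (p k)|)).
apply: wsum_sorted_max.
- move=> i j ij; rewrite size_map size_enum_ord => jd /=.
  by apply: hlam; rewrite // ltnS ij.
- by rewrite perm_sym perm_sort perm_sym; apply: (@perm_map_inj _ _ (fun i => `|v i|)).
- by apply: sort_sorted => x y; apply: le_total.
Qed.

Lemma sort_map_inj {T : eqType} (leT : rel T) d (v : 'I_d -> T) (p : 'I_d -> 'I_d) :
  total leT -> transitive leT -> antisymmetric leT -> injective p ->
  (forall i j : 'I_d, (i <= j)%N -> leT (v (p i)) (v (p j))) ->
  sort leT [seq v i | i <- enum 'I_d] = [seq v (p k) | k <- enum 'I_d].
Proof.
move=> tot tr anti pinj hp; apply: (sorted_eq tr anti).
- exact: sort_sorted.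
- rewrite sorted_map; apply/pairwise_sorted.
  have : pairwise ltn [seq val i | i <- enum 'I_d].
    by rewrite val_enum_ord -(sorted_pairwise ltn_trans) iota_ltn_sorted.
  rewrite pairwise_map; apply: sub_pairwise => i j /= ij; apply: hp.
  exact: ltnW.
- by rewrite perm_sort perm_sym; apply: perm_map_inj.
Qed.

Lemma sorted_l1_eq {R : realType} d (lam : nat -> R) (v : 'I_d -> R) (p : 'I_d -> 'I_d) :
  injective p -> (forall i j : 'I_d, (i <= j)%N -> `|v (p j)| <= `|v (p i)|) ->
  sorted_l1 lam v = \sum_(k < d) lam k.+1 * `|v (p k)|.
Proof.
move=> pinj hp; rewrite sorted_l1_wsum.
rewrite -(wsum_enum (lam \o succn) (fun k => `|v (p k)|)); congr wsum.
apply: (@sort_map_inj _ _ _ (fun i => `|v i|)) => //.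
- by move=> x y; apply: le_total.
- by move=> y x z h1 h2; apply: le_trans h2 h1.
- by move=> x y /andP[h1 h2]; apply/le_anti/andP.
Qed.

Lemma sorting_injection d (e : rel 'I_d) : total e -> transitive e ->
  exists2 p : 'I_d -> 'I_d, injective p & forall i j : 'I_d, (i <= j)%N -> e (p i) (p j).
Proof.
move=> etot etr; have [d0|d0] := posnP d.
  by exists id => // i; move: (ltn_ord i); rewrite {2}d0.
have [x0 _] : exists x0 : 'I_d, True by exists (Ordinal d0).
pose s := sort e (enum 'I_d).
have ss : size s = d by rewrite size_sort size_enum_ord.
exists (fun k => nth x0 s k).
- move=> i j /eqP; rewrite nth_uniq ?ss //; first by move/eqP/val_inj.
  by rewrite sort_uniq enum_uniq.
- move=> i j ij; apply: (sorted_leq_nth etr) => //.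
  + by move=> x; have := etot x x; rewrite orbb.
  + exact: sort_sorted.
  + by rewrite inE ss.
  + by rewrite inE ss.
Qed.

Lemma card_ord_lt d n : (n <= d)%N -> #|[set j : 'I_d | (j < n)%N]%SET| = n.
Proof.
move=> nd; have -> : [set j : 'I_d | (j < n)%N]%SET =
    [set widen_ord nd j | j : 'I_n]%SET.
  apply/setP => j; rewrite inE; apply/idP/imsetP => [jn|[i _ ->]].
    by exists (Ordinal jn) => //; apply/val_inj.
  by rewrite /= ltn_ord.
by rewrite card_imset ?card_ord // => i j /(congr1 val) /= ij; exact/val_inj.
Qed.

(** * Convexity of the sorted norm and first-order optimality *)

(** Order the coordinates by the size of the convex combination, apply the triangle inequality
    termwise, and bound the two sums by the sorted norms, which are maxima over orderings. *)
Lemma sorted_l1_convex {R : realType} d (lam : nat -> R) (u v : 'I_d -> R) t :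
  (forall i j, (0 < i)%N -> (i <= j <= d)%N -> lam j <= lam i) ->
  (forall i, (0 < i <= d)%N -> 0 <= lam i) -> 0 <= t <= 1 ->
  sorted_l1 lam (fun i => (1 - t) * u i + t * v i) <=
  (1 - t) * sorted_l1 lam u + t * sorted_l1 lam v.
Proof.
move=> hlam lam0 /andP[t0 t1].
pose w i := (1 - t) * u i + t * v i.
have [||p pinj hp] := @sorting_injection d (fun i j => `|w j| <= `|w i|).
- by move=> x y; apply: le_total.
- by move=> x y z /= h1 h2; apply: le_trans h2 h1.
rewrite (@sorted_l1_eq _ _ lam w p pinj hp).
apply: (@le_trans _ _ ((1 - t) * (\sum_(k < d) lam k.+1 * `|u (p k)|) +
   t * (\sum_(k < d) lam k.+1 * `|v (p k)|))); last first.
  apply: lerD; apply: ler_wpM2l; rewrite ?subr_ge0 //; exact: sorted_l1_ge.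
rewrite !mulr_sumr -big_split /=; apply: ler_sum => k _.
rewrite /w !(mulrCA _ (lam _)) -mulrDr; apply: ler_wpM2l.
  by apply: lam0; rewrite /= ltn_ord.
apply: (le_trans (ler_normD _ _)).
by rewrite !normrM (ger0_norm t0) ger0_norm ?subr_ge0.
Qed.

Lemma ge0_affine_near0 {R : realType} (A B : R) :
  0 <= B -> (forall t, 0 < t <= 1 -> 0 <= A + t * B) -> 0 <= A.
Proof.
move=> B0 h; rewrite leNgt; apply/negP => A0.
have D0 : 0 < B - A + 1 by lra.
(* For this [t], A + t B = t (A - 1) < 0; the summand 1 keeps the denominator positive. *)
pose t := - A / (B - A + 1).
have ht : t * (B - A + 1) = - A by rewrite /t mulfVK // gt_eqF.
have t0 : 0 < t by rewrite /t divr_gt0 // oppr_gt0.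
have t1 : t <= 1 by rewrite /t ler_pdivrMr //; lra.
have := h t; rewrite t0 t1 => /(_ isT) hh.
nra.
Qed.

(* First-order optimality of the estimator along the segment from it to [th]. *)
Lemma sorted_l1_est_opt {R : realType} d (lam : nat -> R) (sig : R) (y th thh : 'I_d -> R) :
  (forall i j, (0 < i)%N -> (i <= j <= d)%N -> lam j <= lam i) ->
  (forall i, (0 < i <= d)%N -> 0 <= lam i) -> 0 <= sig ->
  is_sorted_l1_est lam sig y thh ->
  2 * \sum_(i < d) (thh i - th i) ^+ 2 <=
  2 * \sum_(i < d) (y i - th i) * (thh i - th i)
    + sig * (sorted_l1 lam th - sorted_l1 lam thh).
Proof.
move=> hlam lam0 sig0 opt.
rewrite -subr_ge0.
(* The comparison at parameter [t] has a factor [t]; after division only t |thh - th|^2 still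
   depends on [t], and it disappears as [t] tends to 0. *)
apply: (@ge0_affine_near0 _ _ (\sum_(i < d) (thh i - th i) ^+ 2)).
  by apply: sumr_ge0 => i _; apply: sqr_ge0.
move=> t /andP[t0 t1].
have := opt (fun i => (1 - t) * thh i + t * th i).
have := @sorted_l1_convex _ _ lam thh th t hlam lam0; rewrite t1 (ltW t0) => /(_ isT).
set L := sorted_l1 _ _; set L1 := sorted_l1 _ _; set L2 := sorted_l1 _ _.
move=> hL ho.
have {hL}hL : sig * L <= sig * ((1 - t) * L1 + t * L2) by apply: ler_wpM2l.
have e : \sum_(i < d) (y i - ((1 - t) * thh i + t * th i)) ^+ 2 =
  \sum_(i < d) (y i - thh i) ^+ 2 +
  t * (2 * \sum_(i < d) (y i - th i) * (thh i - th i)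
   - 2 * \sum_(i < d) (thh i - th i) ^+ 2 + t * \sum_(i < d) (thh i - th i) ^+ 2).
  rewrite !mulr_sumr -sumrB -big_split /= mulr_sumr -big_split /=.
  by apply: eq_bigr => i _; ring.
rewrite e in ho.
rewrite -(pmulr_rge0 _ t0).
nra.
Qed.

(** * Deterministic inequality for the estimator along a lexicographic order *)

(** The support in [in_Theta] is a classical set used as a predicate; the counting lemmas below need
    it as a finite set. *)
Lemma in_ThetaE {R : realType} d s (th : 'I_d -> R) :
  in_Theta s th = (#|[set i | th i != 0%R]%SET| <= s)%N.
Proof.
rewrite /in_Theta; congr (is_true (_ <= _)%N); apply: eq_card => i.
by rewrite inE; apply/idP/idP => [/set_mem|h]; last exact/mem_set.
Qed.

(** For the last clause: among the first k+1 positions at most [s] lie in the support of [th], and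
    the others, where [th] vanishes, are ordered by |z|, so each of them dominates position [k]. *)
Lemma sparse_sort {R : realType} d s (th z : 'I_d -> R) :
  in_Theta s th ->
  exists p : 'I_d -> 'I_d, [/\ injective p,
    (forall i j : 'I_d, (i <= j)%N -> `|th (p j)| <= `|th (p i)|),
    (forall k : 'I_d, (s <= k)%N -> th (p k) = 0) &
    forall k : 'I_d, (s <= k)%N ->
      (k.+1 - s <= #|[set i | (`|z (p k)| <= `|z i|)%R]%SET|)%N].
Proof.
rewrite in_ThetaE => sth.
pose e i j := (`|th j| < `|th i|) || (`|th j| == `|th i|) && (`|z j| <= `|z i|).
have [||p pinj hp] := @sorting_injection d e.
- move=> i j; rewrite /e; case: (ltgtP `|th i| `|th j|) => //= _; exact: le_total.
- move=> j i k; rewrite /e => /orP[h1|/andP[/eqP h1 h2]] /orP[h3|/andP[/eqP h3 h4]].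
  + by rewrite (lt_trans h3 h1).
  + by rewrite h3 h1.
  + by rewrite -h1 h3.
  + by rewrite h3 h1 eqxx (le_trans h4 h2) orbT.
have thp (i j : 'I_d) : (i <= j)%N -> `|th (p j)| <= `|th (p i)|.
  by move=> /hp /orP[/ltW //|/andP[/eqP -> _]].
have cardk (k : 'I_d) : #|[set p j | j : 'I_d & (j <= k)%N]%SET| = k.+1.
  by rewrite card_imset // -(card_ord_lt (ltn_ord k)).
have th0 (k : 'I_d) : (s <= k)%N -> th (p k) = 0.
  move=> sk; apply/eqP/negPn/negP => thk.
  have : (k.+1 <= s)%N; last by rewrite ltnNge sk.
  apply: leq_trans sth; rewrite -(cardk k); apply/subset_leq_card/fintype.subsetP => i.
  case/imsetP => j; rewrite inE => jk ->; rewrite inE -normr_gt0.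
  by apply: lt_le_trans (thp _ _ jk); rewrite normr_gt0.
exists p; split => // k sk.
apply: (@leq_trans #|[set p j | j : 'I_d & (j <= k)%N]%SET :\: [set i | th i != 0%R]%SET|).
  rewrite cardsD cardk; apply: leq_sub2l; apply: leq_trans sth.
  by apply: subset_leq_card; apply: finset.subsetIr.
apply/subset_leq_card/fintype.subsetP => i; rewrite !inE negbK => /andP[/eqP thi /imsetP[j]].
rewrite inE => jk ij; have := hp _ _ jk; rewrite /e -ij thi th0 // ltxx eqxx.
by [].
Qed.

(** This and the next two lemmas complete squares coordinate by coordinate, with [Y] = sigma |z_k|,
    [L] = sigmatilde lambda_k and [x] = |u_k|, where u = thetahat - theta. *)
Lemma young_head {R : realType} (Y L x : R) :
  4 * Y * x + L * x - 2 * x ^+ 2 <= 4 * Y ^+ 2 + L ^+ 2 / 4.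
Proof.
rewrite -subr_ge0 (_ : _ - _ = 2 * (x - Y - L / 4) ^+ 2 + 2 * (Y - L / 4) ^+ 2); last by field.
by rewrite addr_ge0 // mulr_ge0 // sqr_ge0.
Qed.

Lemma young_mid {R : realType} (Y L x : R) : 0 <= L * x ->
  4 * Y * x - L * x - 2 * x ^+ 2 <= 2 * Y ^+ 2.
Proof.
move=> h; rewrite -subr_ge0 (_ : _ - _ = 2 * (x - Y) ^+ 2 + L * x); last by ring.
by rewrite addr_ge0 // mulr_ge0 // sqr_ge0.
Qed.

Lemma young_sqr {R : realType} (L x : R) : - x ^+ 2 + L * x <= L ^+ 2 / 4.
Proof.
rewrite -subr_ge0 (_ : _ - _ = (x - L / 2) ^+ 2); last by field.
exact: sqr_ge0.
Qed.

(** The quantity bounded is |Y - thh|^2 - sig^2 |z|^2. The four terms pay for the noise on the first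
    2s positions, the later positions where the noise exceeds lambda/8, the event that [sigt] is too
    small, and the penalty on the first [s] positions. *)
Lemma slope_core {R : realType} d s (lam : nat -> R) (sig sigt : R) (th z thh : 'I_d -> R) :
  (forall i j, (0 < i)%N -> (i <= j <= d)%N -> lam j <= lam i) ->
  (forall i, (0 < i <= d)%N -> 0 <= lam i) -> 0 < sig -> 0 <= sigt -> in_Theta s th ->
  is_sorted_l1_est lam sigt (fun i => th i + sig * z i) thh ->
  exists p : 'I_d -> 'I_d, [/\ injective p,
   (forall k : 'I_d, (s <= k)%N ->
      (k.+1 - s <= #|[set i | (`|z (p k)| <= `|z i|)%R]%SET|)%N) &
   `| \sum_(i < d) (thh i - th i) ^+ 2 - 2 * sig * \sum_(i < d) z i * (thh i - th i) | <=
   \sum_(k < d) ((k < 2 * s)%N%:R * (4 * sig ^+ 2 * z (p k) ^+ 2)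
     + (2 * s <= k)%N%:R * (`|z (p k)| > lam k.+1 / 8)%R%:R * (2 * sig ^+ 2 * z (p k) ^+ 2)
     + (sigt < sig / 2)%R%:R * (2 * sig ^+ 2 * z (p k) ^+ 2)
     + (k < s)%N%:R * (sigt ^+ 2 * lam k.+1 ^+ 2 / 4))].
Proof.
move=> hlam lam0 sig0 sigt0 sth opt.
have [p [pinj thp th0 hcard]] := @sparse_sort _ _ _ th z sth.
exists p; split => //.
have := sorted_l1_est_opt th hlam lam0 sigt0 opt.
(* The norm of [thh] is bounded below along the order of [th]. A position below [s] contributes at
   most +|u_k|; from [s] on [th] vanishes and the contribution is exactly -|u_k|. *)
have hD : sorted_l1 lam th - sorted_l1 lam thh <=
    \sum_(k < d) lam k.+1 * ((-1) ^+ (s <= k)%N * `|thh (p k) - th (p k)|).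
  apply: (@le_trans _ _ (\sum_(k < d) lam k.+1 * `|th (p k)| -
     \sum_(k < d) lam k.+1 * `|thh (p k)|)).
    rewrite (sorted_l1_eq _ pinj thp) lerD2l lerN2; exact: sorted_l1_ge.
  rewrite -sumrB; apply: ler_sum => k _; rewrite -mulrBr.
  apply: ler_wpM2l; first by apply: lam0; rewrite /= ltn_ord.
  case: leqP => [sk|_]; first by rewrite th0 // normr0 sub0r subr0 expr1 mulN1r.
  by rewrite expr0 mul1r distrC; exact: lerB_dist.
move: hD => /(ler_wpM2l sigt0) hD /le_trans.
move=> /(_ _ (lerD (lexx _) hD)) {hD}.
have -> : \sum_(i < d) (th i + sig * z i - th i) * (thh i - th i) =
   sig * \sum_(i < d) z i * (thh i - th i).
  by rewrite mulr_sumr; apply: eq_bigr => i _; ring.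
rewrite [\sum_(i < d) (_ i - _ i) ^+ 2](reindex_inj pinj) /=.
rewrite [\sum_(i < d) z i * _](reindex_inj pinj) /=.
set U := \sum_(i < d) (_ - _) ^+ 2; set V := \sum_(i < d) _ * _.
set E := \sum_(k < d) lam _ * _; set Q := \sum_(k < d) _.
move=> hopt.
have h1 : - U + sigt * E <= Q.
  rewrite /U /E /Q mulr_sumr -sumrN -big_split /=; apply: ler_sum => k _.
  have lk : 0 <= lam k.+1 by apply: lam0; rewrite /= ltn_ord.
  set u := thh _ - _; set a := z _.
  have u0 : 0 <= `|u| by [].
  have a0 : 0 <= a ^+ 2 by exact: sqr_ge0.
  have s0 : 0 <= sig ^+ 2 by exact: sqr_ge0.
  have sa : 0 <= sig ^+ 2 * a ^+ 2 by apply: mulr_ge0.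
  have nneg (b c e f : bool) : 0 <= b%:R * (4 * sig ^+ 2 * a ^+ 2)
     + c%:R * e%:R * (2 * sig ^+ 2 * a ^+ 2) + f%:R * (2 * sig ^+ 2 * a ^+ 2) :> R.
    have q (h : bool) (v : R) : 0 <= v -> 0 <= h%:R * (v * sig ^+ 2 * a ^+ 2).
      by move=> v0; rewrite mulr_ge0 // -mulrA mulr_ge0.
    by rewrite addr_ge0 ?q // addr_ge0 ?q // -mulrA mulr_ge0 ?q.
  apply: (@le_trans _ _ ((k < s)%N%:R * (sigt ^+ 2 * lam k.+1 ^+ 2 / 4))); last first.
    by rewrite lerDr nneg.
  rewrite -[u ^+ 2]real_normK ?num_real //.
  have sl : 0 <= sigt * lam k.+1 by apply: mulr_ge0.
  rewrite mulrCA mulrA -exprMn.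
  case: leqP => [sk|sk].
    rewrite [lam _ * _]mulrC expr1 mul0r mulN1r mulrN subr_le0.
    by apply: (le_trans _ (mulr_ge0 sl u0)); rewrite oppr_le0 sqr_ge0.
  by rewrite expr0 !mul1r [lam _ * _]mulrC; exact: young_sqr.
have h2 : 4 * sig * V + sigt * E - 2 * U <= Q.
  rewrite /U /E /V /Q !mulr_sumr -big_split -sumrB /=; apply: ler_sum => k _.
  have lk : 0 <= lam k.+1 by apply: lam0; rewrite /= ltn_ord.
  set u := thh _ - _; set a := z _.
  have u0 : 0 <= `|u| by [].
  have a0 : 0 <= `|a| by [].
  have au : a * u <= `|a| * `|u| by rewrite -normrM ler_norm.
  rewrite -[u ^+ 2]real_normK ?num_real // -[a ^+ 2]real_normK ?num_real //.
  move: u0 a0 au; set x := `|u|; set y := `|a|; move: (a * u) => w u0 a0 au.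
  have sl : 0 <= sigt * lam k.+1 by apply: mulr_ge0.
  have sy : 0 <= sig * y by apply: mulr_ge0 => //; exact: ltW.
  have wxy : 4 * sig * w <= 4 * (sig * y) * x.
    by rewrite -!mulrA ler_pM2l // ler_pM2l.
  apply: (@le_trans _ _ (4 * (sig * y) * x + sigt * (lam k.+1 * ((-1) ^+ (s <= k)%N * x)) - 2 * x ^+ 2)).
    by rewrite !lerD2r.
  have sy2 : sig ^+ 2 * y ^+ 2 = (sig * y) ^+ 2 by rewrite exprMn.
  have sl2 : sigt ^+ 2 * lam k.+1 ^+ 2 = (sigt * lam k.+1) ^+ 2 by rewrite exprMn.
  (* Origin of the thresholds 1/8 and 1/2: 4 sig y <= sig lambda / 2 <= sigt lambda, so the penalty
     absorbs the cross term. *)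
  have bad : lam k.+1 / 8 >= y -> sig / 2 <= sigt -> 4 * (sig * y) * x <= sigt * lam k.+1 * x.
    move=> h3 h4; apply: ler_wpM2r => //.
    have : sig * y <= sig * (lam k.+1 / 8) by rewrite ler_pM2l.
    have : sig / 2 * lam k.+1 <= sigt * lam k.+1 by apply: ler_wpM2r.
    lra.
  rewrite -!(mulrA _ (sig ^+ 2)) sy2 sl2.
  rewrite (_ : sigt * (lam k.+1 * ((-1) ^+ (s <= k)%N * x)) =
    (-1) ^+ (s <= k)%N * (sigt * lam k.+1 * x)); last first.
    by move: ((-1) ^+ _) => ee; ring.
  have slx : 0 <= sigt * lam k.+1 * x by apply: mulr_ge0.
  have Y20 (b : bool) : 0 <= b%:R * (2 * (sig * y) ^+ 2) by rewrite mulr_ge0 // mulr_ge0 // sqr_ge0.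
  have hmid := young_mid (sig * y) slx.
  case: (ltnP k s) => [ks|ks].
    have k2s : (k < 2 * s)%N by rewrite (leq_trans ks) // leq_pmull.
    rewrite k2s leqNgt k2s expr0 !mul1r /= !mul0r !addr0.
    apply: (le_trans (young_head _ _ _)).
    by rewrite lerD2r lerDl.
  rewrite expr1 mulN1r mul0r addr0.
  case: (ltnP k (2 * s)) => [k2s|k2s].
    rewrite mul1r !mul0r addr0; apply: (le_trans hmid).
    rewrite -[leLHS]addr0 lerD // ler_wpM2r ?sqr_ge0 //.
    by rewrite ler_nat.
  rewrite mul0r add0r mul1r.
  case: (ltP sigt (sig / 2)) => [hs|hs].
    by apply: (le_trans hmid); rewrite mul1r lerDr.
  rewrite mul0r addr0; case: (ltP _ y) => hy; first by rewrite mul1r.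
  rewrite mul0r; apply: (@le_trans _ _ (- (2 * x ^+ 2))).
    by rewrite gerDr subr_le0; exact: bad.
  by rewrite oppr_le0 mulr_ge0 ?sqr_ge0.
(* Optimality reads 2 U <= 2 sig V + sigt E. Hence U - 2 sig V <= -U + sigt E, bounded by [h1], and
   2 sig V - U <= 2 sig V <= 4 sig V + sigt E - 2 U, bounded by [h2]. *)
have U0 : 0 <= U by apply: sumr_ge0 => i _; exact: sqr_ge0.
rewrite ler_norml; apply/andP; split; lra.
Qed.

(** * Integrals of products of independent variables, and bounds on means *)

Import HBNNSimple.

(** The integral of a nonnegative function is the supremum over the simple functions below it, hence
    monotone even for the possibly nonmeasurable loss. *)
Lemma ge0_integral_le_nomeas {d0 : measure_display} {T : measurableType d0} {R : realType}
    (P : {measure set T -> \bar R}) (f g : T -> \bar R) :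
  (forall x, 0 <= f x)%E -> (forall x, f x <= g x)%E ->
  (\int[P]_x f x <= \int[P]_x g x)%E.
Proof.
move=> f0 fg; rewrite !ge0_integralTE //; last by move=> x; apply: le_trans (fg x).
apply: ereal_sup_le => y [h hf <-]; exists h => // x.
by apply: le_trans (fg x).
Qed.

(** The identity passes from indicators to simple functions by linearity and to [h] by monotone
    convergence. It splits one factor off a product, [g] being the product of the others and [c] its
    mean. *)
Lemma ge0_integral_weight {d0 d1 : measure_display} {S : measurableType d1}
    {T : measurableType d0} {R : realType}
    (P : {measure set T -> \bar R}) (mu : {measure set S -> \bar R})
    (X : T -> S) (g : T -> R) (c : R) (h : S -> R) :
  measurable_fun setT X -> measurable_fun setT g -> (forall w, 0 <= g w) -> 0 <= c ->
  (forall A, measurable A ->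
    \int[P]_w (\1_A (X w) * g w)%:E = mu A * c%:E)%E ->
  measurable_fun setT h -> (forall x, 0 <= h x) ->
  (\int[P]_w (h (X w) * g w)%:E = (\int[mu]_x (h x)%:E) * c%:E)%E.
Proof.
move=> mX mg g0 c0 hA mh h0.
have /measurable_EFinP mE := mh.
have h0' x : setT x -> (0 <= (EFin \o h) x)%E by rewrite lee_fin.
pose phi := nnsfun_approx measurableT mE.
have cphi x : (phi n x)%:E @[n --> \oo] --> (h x)%:E.
  exact: (@cvg_nnsfun_approx _ _ _ _ measurableT _ mE h0' x Logic.I).
have mphi n : measurable_fun setT (fun w => phi n (X w)).
  by apply: measurableT_comp.
have -> : (\int[mu]_x (h x)%:E = limn (fun n => \int[mu]_x (phi n x)%:E))%E.
  rewrite -monotone_convergence //.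
  - by apply: eq_integral => x _; apply/esym/cvg_lim => //; exact: cphi.
  - by move=> n; apply/measurable_EFinP.
  - by move=> n x _; rewrite lee_fin.
  - by move=> x _ a b ab; rewrite lee_fin; exact/lefP/nd_nnsfun_approx.
have -> : (\int[P]_w (h (X w) * g w)%:E =
    limn (fun n => \int[P]_w (phi n (X w) * g w)%:E))%E.
  rewrite -monotone_convergence //.
  - apply: eq_integral => w _; apply/esym/cvg_lim => //.
    rewrite EFinM; under eq_fun do rewrite EFinM.
    by apply: cvgeZr => //; exact: cphi.
  - by move=> n; apply/measurable_EFinP; exact: measurable_funM.
  - by move=> n w _; rewrite lee_fin mulr_ge0.
  - move=> w _ a b ab; rewrite lee_fin ler_wpM2r //.
    exact/lefP/nd_nnsfun_approx.
have step n : (\int[P]_w (phi n (X w) * g w)%:E = (\int[mu]_x (phi n x)%:E) * c%:E)%E.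
  rewrite integralT_nnsfun sintegralE.
  transitivity (\int[P]_w (\sum_(y \in range (phi n))
      ((y * \1_(phi n @^-1` [set y]) (X w))%:E * (g w)%:E)))%E.
    apply: eq_integral => w _; rewrite -ge0_mule_fsuml; last first.
      by move=> y; exact: nnfun_muleindic_ge0.
    by rewrite fsumEFin // -(fimfunE _ (X w)) -EFinM.
  have mi y : measurable_fun setT (fun w => \1_(phi n @^-1` [set y]) (X w) : R).
    have : measurable_fun setT (\1_(X @^-1` (phi n @^-1` [set y])) : T -> R).
      by apply: measurable_indic; rewrite -[_ @^-1` _]setTI; exact: mX.
    by apply: eq_measurable_fun => w _; rewrite !indicE.
  rewrite ge0_integral_fsum //; last 2 first.
  - move=> y; under eq_fun do rewrite -EFinM; apply/measurable_EFinP.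
    by apply: measurable_funM => //; exact: measurable_funM.
  - by move=> y w _; rewrite mule_ge0 ?nnfun_muleindic_ge0 ?lee_fin.
  rewrite ge0_mule_fsuml; last by move=> y; exact: nnsfun_mulemu_ge0.
  apply: eq_fsbigr => y; rewrite inE => -[x _ xy].
  transitivity (\int[P]_w (y%:E * (\1_(phi n @^-1` [set y]) (X w) * g w)%:E))%E.
    by apply: eq_integral => w _; rewrite -!EFinM mulrA.
  rewrite ge0_integralZl //.
  - by rewrite hA // muleA.
  - by apply/measurable_EFinP; exact: measurable_funM.
  - by move=> w _; rewrite lee_fin mulr_ge0.
  - by rewrite lee_fin -xy.
under eq_fun do rewrite step.
apply/cvg_lim => //; apply: cvgeZr => //.
apply: ereal_nondecreasing_is_cvgn => a b ab; apply: ge0_integral_le_nomeas => x.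
  by rewrite lee_fin.
by rewrite lee_fin; exact/lefP/nd_nnsfun_approx.
Qed.

(** Induction on the number [n] of leading coordinates that may carry a general function, the others
    carrying indicators. With indicators only, this is the definition of independence. In the step,
    coordinate [n] is first given an arbitrary indicator, which the induction hypothesis handles,
    and is then upgraded by [ge0_integral_weight]. *)
Lemma iid_integral_prod {R : realType} {d0 : measure_display} {Omega : measurableType d0}
    (P : probability Omega R) d (xi : 'I_d -> Omega -> R) (mu : probability R R)
    (f : 'I_d -> R -> R) (e : 'I_d -> R) :
  iid_with P xi mu ->
  (forall i, measurable_fun setT (f i)) -> (forall i x, 0 <= f i x) ->
  (forall i, \int[mu]_x (f i x)%:E = (e i)%:E)%E ->
  (\int[P]_w (\prod_(i < d) f i (xi i w))%:E = (\prod_(i < d) e i)%:E)%E.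
Proof.
move=> [mxi [dxi ind]].
have main n : forall (f : 'I_d -> R -> R) (e : 'I_d -> R),
  (forall i, measurable_fun setT (f i)) -> (forall i x, 0 <= f i x) ->
  (forall i, \int[mu]_x (f i x)%:E = (e i)%:E)%E ->
  (forall i : 'I_d, (n <= i)%N -> exists A, measurable A /\ f i = \1_A) ->
  (\int[P]_w (\prod_(i < d) f i (xi i w))%:E = (\prod_(i < d) e i)%:E)%E; last first.
  by move=> mf f0 fe; apply: (main d) => // i; rewrite leqNgt ltn_ord.
elim: n => [|n IH] {}f {}e mf f0 fe hf.
  have /choice[A hA] i := hf i (leq0n i).
  have mA i : measurable (A i) by case: (hA i).
  have mxA i : measurable (xi i @^-1` A i).
    by rewrite -[_ @^-1` _]setTI; exact: mxi.
  transitivity (\int[P]_w (\1_(\bigcap_(i in [set: 'I_d]) (xi i @^-1` A i)) w)%:E)%E.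
    apply: eq_integral => w _; congr (_%:E); rewrite indicE.
    case: (boolP (w \in _)) => [/set_mem hw|hw].
      by apply: big1 => i _; rewrite (hA i).2 indicE mem_set //; exact: (hw i).
    have [i hi] : exists i, ~ A i (xi i w).
      apply/existsNP => hall; move/negP: hw; apply; apply/mem_set => i _; exact: hall.
    rewrite (bigD1 i) //= (hA i).2 indicE memNset ?mul0r //.
  rewrite integral_indic //; last by apply: fin_bigcap_measurable.
  rewrite setIT; transitivity (\prod_(i < d) P (xi i @^-1` A i))%E; first exact: ind.
  rewrite -prodEFin; apply: eq_bigr => i _.
  rewrite dxi // -fe (hA i).2 integral_indic //.
  by rewrite setIT.
have [dn|nd] := leqP d n.
  by apply: IH => // i ni; move: (ltn_ord i); lia.
pose k := Ordinal nd.
have e0 i : 0 <= e i by rewrite -lee_fin -fe integral_ge0 // => x _; rewrite lee_fin.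
pose g w := \prod_(i < d | i != k) f i (xi i w).
have mfx i : measurable_fun setT (fun w => f i (xi i w)).
  exact: (measurableT_comp (mf i) (mxi i)).
have mg : measurable_fun setT g.
  rewrite /g; under eq_fun do rewrite big_mkcond /=.
  by apply: measurable_prod => i _; case: (i != k).
have g0 w : 0 <= g w by apply: prodr_ge0.
transitivity (\int[P]_w (f k (xi k w) * g w)%:E)%E.
  by apply: eq_integral => w _; rewrite (bigD1 k).
rewrite (@ge0_integral_weight _ _ _ _ _ P mu (xi k) g (\prod_(i < d | i != k) e i) (f k)) //.
- by rewrite fe -EFinM [in RHS](bigD1 k).
- by apply: prodr_ge0.
move=> A mA.
pose f' i : R -> R := if i == k then \1_A else f i.
pose e' i : R := if i == k then fine (mu A) else e i.
have := IH f' e'.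
have e'k : e' k = fine (mu A) by rewrite /e' eqxx.
have f'k : f' k = \1_A by rewrite /f' eqxx.
have -> : \prod_(i < d) e' i = fine (mu A) * \prod_(i < d | i != k) e i.
  by rewrite (bigD1 k) //= e'k; congr (_ * _); apply: eq_bigr => i /negPf ik; rewrite /e' ik.
have -> : (mu A * (\prod_(i < d | i != k) e i)%:E =
   (fine (mu A) * \prod_(i < d | i != k) e i)%:E)%E.
  by rewrite EFinM fineK // fin_num_measure.
move=> <-.
- apply: eq_integral => w _; rewrite (bigD1 k) //= f'k.
  by congr (_ * _)%:E; apply: eq_bigr => i /negPf ik; rewrite /f' ik.
- move=> i; rewrite /f'; case: eqP => // _; exact: measurable_indic.
- by move=> i x; rewrite /f'; case: eqP.
- move=> i; rewrite /f' /e'; case: eqP => // _.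
  by rewrite integral_indic // setIT fineK // fin_num_measure.
- move=> i ni; rewrite /f'; case: eqP => [_|ik]; first by exists A.
  apply: hf; rewrite ltn_neqAle ni andbT; apply/eqP => nik; apply: ik.
  exact/val_inj.
Qed.

(* [Ebound P f c] packages "[f] is nonnegative, measurable and has mean at most [c]",
   a notion closed under nonnegative linear combinations. *)
Definition Ebound {R : realType} {d0 : measure_display} {T : measurableType d0}
    (P : {measure set T -> \bar R}) (f : T -> R) (c : R) : Prop :=
  [/\ measurable_fun setT f, (forall w, 0 <= f w) & (\int[P]_w (f w)%:E <= c%:E)%E].

Section Ebound.
Context {R : realType} {d0 : measure_display} {T : measurableType d0}.
Variable P : probability T R.

Lemma Ebound_add f g a b : Ebound P f a -> Ebound P g b ->
  Ebound P (fun w => f w + g w) (a + b).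
Proof.
move=> [mf f0 hf] [mg g0 hg]; split.
- exact: measurable_funD.
- by move=> w; rewrite addr_ge0.
under eq_integral do rewrite EFinD.
rewrite ge0_integralD //; first by rewrite EFinD leeD.
- by move=> w _; rewrite lee_fin.
- exact/measurable_EFinP.
- by move=> w _; rewrite lee_fin.
- exact/measurable_EFinP.
Qed.

Lemma Ebound_scale f a k : 0 <= k -> Ebound P f a -> Ebound P (fun w => k * f w) (k * a).
Proof.
move=> k0 [mf f0 hf]; split.
- exact: measurable_funM.
- by move=> w; rewrite mulr_ge0.
under eq_integral do rewrite EFinM.
rewrite ge0_integralZl_EFin //; first by rewrite EFinM; apply: lee_wpmul2l; rewrite ?lee_fin.
- by move=> w _; rewrite lee_fin.
- exact/measurable_EFinP.
Qed.

Lemma Ebound_cst k : 0 <= k -> Ebound P (cst k) k.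
Proof.
move=> k0; split => //.
suff -> : (\int[P]_w (cst k w)%:E = k%:E)%E by [].
transitivity (k%:E * P setT)%E; first exact: (integral_cst P measurableT k%:E).
by rewrite probability_setT mule1.
Qed.

Lemma Ebound_sum (I : Type) (r : seq I) (p : pred I) (f : I -> T -> R) (a : I -> R) :
  (forall i, p i -> Ebound P (f i) (a i)) ->
  Ebound P (fun w => \sum_(i <- r | p i) f i w) (\sum_(i <- r | p i) a i).
Proof.
move=> h; elim: r => [|i r IH].
  rewrite big_nil; have -> : (fun w => \sum_(i <- [::] | p i) f i w) = cst 0.
    by apply/funext => w; rewrite big_nil.
  exact: Ebound_cst.
rewrite big_cons; under eq_fun do rewrite big_cons.
by case: ifP => // pi; apply: Ebound_add => //; exact: h.
Qed.

Lemma Ebound_le f a b : a <= b -> Ebound P f a -> Ebound P f b.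
Proof. by move=> ab [mf f0 hf]; split => //; apply: le_trans hf _; rewrite lee_fin. Qed.

Lemma Ebound_integral f a : Ebound P f a ->
  exists2 b, 0 <= b <= a & (\int[P]_w (f w)%:E = b%:E)%E.
Proof.
move=> [mf f0 hf]; have h0 : (0 <= \int[P]_w (f w)%:E)%E.
  by apply: integral_ge0 => w _; rewrite lee_fin.
move: h0 hf; case: (\int[P]_w (f w)%:E)%E => // b; rewrite !lee_fin => b0 ba.
by exists b; rewrite ?b0.
Qed.

End Ebound.

Lemma iid_Ebound_prod {R : realType} {d0 : measure_display} {Omega : measurableType d0}
    (P : probability Omega R) d (xi : 'I_d -> Omega -> R) (mu : probability R R)
    (f : 'I_d -> R -> R) (e : 'I_d -> R) :
  iid_with P xi mu -> (forall i, Ebound mu (f i) (e i)) ->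
  Ebound P (fun w => \prod_(i < d) f i (xi i w)) (\prod_(i < d) e i).
Proof.
move=> iid h.
have /choice[b hb] i : exists b, (0 <= b <= e i) /\ (\int[mu]_w (f i w)%:E = b%:E)%E.
  by have [b] := Ebound_integral (h i); exists b.
split.
- apply: measurable_prod => i _; case: iid => mxi _.
  by case: (h i) => mf _ _; exact: (measurableT_comp mf (mxi i)).
- by move=> w; apply: prodr_ge0 => i _; case: (h i).
- rewrite (@iid_integral_prod _ _ _ _ _ _ _ _ b iid).
  + by rewrite lee_fin; apply: ler_prod => i _; case: (hb i).
  + by move=> i; case: (h i).
  + by move=> i x; case: (h i).
  + by move=> i; case: (hb i).
Qed.

Lemma iid_Ebound_prod_set {R : realType} {d0 : measure_display} {Omega : measurableType d0}
    (P : probability Omega R) d (xi : 'I_d -> Omega -> R) (mu : probability R R)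
    (f : R -> R) (e : R) (A : {set 'I_d}) :
  iid_with P xi mu -> Ebound mu f e ->
  Ebound P (fun w => \prod_(i in A) f (xi i w)) (e ^+ #|A|).
Proof.
move=> iid h.
have := @iid_Ebound_prod _ _ _ P d xi mu (fun i => if i \in A then f else cst 1)
  (fun i => if i \in A then e else 1) iid.
rewrite -big_mkcond prodr_const.
have -> : (fun w => \prod_(i < d) (if i \in A then f else cst 1) (xi i w)) =
  (fun w => \prod_(i in A) f (xi i w)).
  by apply/funext => w; rewrite [RHS]big_mkcond; apply: eq_bigr => i _; case: ifP.
by apply=> i; case: ifP => _ //; exact: Ebound_cst.
Qed.

Lemma iid_Ebound {R : realType} {d0 : measure_display} {Omega : measurableType d0}
    (P : probability Omega R) d (xi : 'I_d -> Omega -> R) (mu : probability R R)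
    (f : R -> R) (e : R) (i : 'I_d) :
  iid_with P xi mu -> Ebound mu f e -> Ebound P (fun w => f (xi i w)) e.
Proof.
move=> iid h; have := iid_Ebound_prod_set [set i]%SET iid h.
by rewrite cards1 expr1; under eq_fun do rewrite big_set1.
Qed.

(** * Moments from tail bounds *)

Lemma measurable_abs_gt {R : realType} (t : R) : measurable [set x : R | t < `|x|].
Proof.
rewrite -[X in measurable X]setTI.
have h := @measurable_fun_ltr _ R R setT (cst t) (fun x => `|x|) (measurable_cst t)
  (@normr_measurable R setT).
by have := h measurableT [set true] Logic.I; congr measurable.
Qed.

Lemma abs_gt_indic {R : realType} (t : R) :
  (fun x : R => (t < `|x|)%R%:R) = \1_[set x : R | t < `|x|] :> (R -> R).
Proof.
apply/funext => x; rewrite indicE; congr (nat_of_bool _)%:R.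
by apply/idP/idP => [h|/set_mem //]; apply/mem_set.
Qed.

Lemma measurable_abs_gt_fun {R : realType} (t : R) :
  measurable_fun setT (fun x : R => (t < `|x|)%R%:R : R).
Proof. rewrite abs_gt_indic; apply: measurable_indic; exact: measurable_abs_gt. Qed.

Lemma geometric_sum_le {R : realType} (a r : R) n :
  0 <= a -> 0 <= r -> r < 1 -> \sum_(0 <= l < n) a * r ^+ l <= a / (1 - r).
Proof.
move=> a0 r0 r1; have d0 : 0 < 1 - r by rewrite subr_gt0.
rewrite -mulr_sumr ler_wpM2l // -[leRHS]mul1r ler_pdivlMr //.
rewrite big_mkord mulrC -opprB mulNr -subrX1 opprB.
by rewrite gerBl exprn_ge0.
Qed.

(* Dyadic decomposition of [|x| > t] into the shells [2^l t < |x| <= 2^(l+1) t]. *)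
Lemma tail_moment {R : realType} (mu : probability R R) (k : nat) (t D b : R) :
  0 < t -> 0 <= D -> 2 ^+ k * 2 `^ (- b) < 1 ->
  (forall x, t <= x -> (mu [set y : R | (x < `|y|)%R] <= (D * x `^ (- b))%:E)%E) ->
  Ebound mu (fun x => `|x| ^+ k * (t < `|x|)%R%:R)
    (2 ^+ k * t ^+ k * (D * t `^ (- b)) / (1 - 2 ^+ k * 2 `^ (- b))).
Proof.
move=> t0 D0 r1 htail.
set a := 2 ^+ k * _ * _; set r := 2 ^+ k * _ in r1 *.
have r0 : 0 <= r by rewrite mulr_ge0 ?exprn_ge0 ?powR_ge0.
have a0 : 0 <= a by rewrite !mulr_ge0 ?exprn_ge0 ?powR_ge0 // ltW.
have mf : measurable_fun setT (fun x : R => `|x| ^+ k * (t < `|x|)%R%:R).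
  apply: measurable_funM; last exact: measurable_abs_gt_fun.
  by apply: measurable_funX; exact: normr_measurable.
have f0 (x : R) : 0 <= `|x| ^+ k * (t < `|x|)%R%:R by rewrite mulr_ge0 ?exprn_ge0.
split => //.
(* [g l] majorises |x|^k on shell [l], but its indicator covers all of |x| > 2^l t, so its integral
   is a multiple of a tail probability. *)
pose g l (x : R) := (2 ^+ l.+1 * t) ^+ k * (2 ^+ l * t < `|x|)%R%:R.
have g0 l x : 0 <= g l x by rewrite mulr_ge0 ?exprn_ge0 // mulr_ge0 ?exprn_ge0 // ltW.
have mg l : measurable_fun setT (g l).
  by apply: measurable_funM => //; exact: measurable_abs_gt_fun.
apply: (@le_trans _ _ (\int[mu]_x (\sum_(0 <= l <oo) (g l x)%:E))%E).
  apply: ge0_integral_le_nomeas => x; first by rewrite lee_fin.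
  have [xt|tx] := leP `|x| t.
    by rewrite mulr0; apply: nneseries_ge0 => l _ _; rewrite lee_fin.
  have hex : exists n, `|x| <= 2 ^+ n * t.
    exists (Num.truncn (`|x| / t)).+1.
    rewrite -ler_pdivrMr //; apply: (@le_trans _ _ (Num.truncn (`|x| / t)).+1%:R).
      by apply/ltW; apply: truncnS_gt.
    by rewrite -natrX ler_nat ltnW // ltn_expl.
  (* The least n with |x| <= 2^n t is positive because |x| > t; its predecessor is the index of the
     shell. *)
  case: (ex_minnP hex) => -[|l]; first by rewrite expr0 mul1r leNgt tx.
  move=> hl hmin; have hl' : 2 ^+ l * t < `|x|.
    by rewrite ltNge; apply/negP => /hmin; rewrite ltnn.
  apply: (@le_trans _ _ (\sum_(0 <= i < l.+1) (g i x)%:E)%E); last first.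
    by apply: nneseries_lim_ge => i _ _; rewrite lee_fin.
  rewrite big_nat_recr //= -[leLHS]add0e; apply: leeD.
    by apply: sume_ge0 => i _; rewrite lee_fin.
  by rewrite lee_fin /g hl' !mulr1 lerXn2r // nnegrE ?mulr_ge0 ?exprn_ge0 // ltW.
rewrite integral_nneseries //; last 2 first.
- by move=> l; apply/measurable_EFinP.
- by move=> l x _; rewrite lee_fin.
have hint l : (\int[mu]_x (g l x)%:E <= (a * r ^+ l)%:E)%E.
  have tl : t <= 2 ^+ l * t by rewrite ler_peMl ?exprn_ege1 ?ltW // ltr1n.
  under eq_integral do rewrite EFinM.
  rewrite ge0_integralZl_EFin //; last 2 first.
  - by apply/measurable_EFinP; exact: measurable_abs_gt_fun.
  - by rewrite exprn_ge0 // mulr_ge0 ?exprn_ge0 // ltW.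
  have -> : (\int[mu]_x ((2 ^+ l * t < `|x|)%R%:R)%:E = mu [set x : R | (2 ^+ l * t < `|x|)%R])%E.
    rewrite (_ : (fun x : R => _) = fun x => (\1_[set x : R | (2 ^+ l * t < `|x|)%R] x)%:E).
      by rewrite integral_indic ?setIT //; exact: measurable_abs_gt.
    by rewrite -abs_gt_indic.
  apply: (@le_trans _ _ (((2 ^+ l.+1 * t) ^+ k)%:E * (D * (2 ^+ l * t) `^ (- b))%:E)%E).
    apply: lee_wpmul2l; last exact: htail.
    by rewrite lee_fin exprn_ge0 // mulr_ge0 ?exprn_ge0 // ltW.
  rewrite -EFinM lee_fin powRM ?exprn_ge0 ?(ltW t0) //.
  have -> : (2 ^+ l) `^ (- b) = (2 `^ (- b)) ^+ l :> R.
    by rewrite -(powR_mulrn l (powR_ge0 2 (- b))) -(powR_mulrn l (ler0n R 2)) -!powRrM mulrC.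
  have -> : (2 ^+ l.+1 * t) ^+ k = 2 ^+ k * (2 ^+ k) ^+ l * t ^+ k.
    by rewrite exprMn exprS exprMn -!exprM mulnC.
  rewrite /a /r exprMn.
  by rewrite le_eqVlt; apply/orP; left; apply/eqP; ring.
apply: (@le_trans _ _ (\sum_(0 <= l <oo) (a * r ^+ l)%:E)%E).
  by apply: lee_nneseries => // l _ _; apply: integral_ge0 => x _; rewrite lee_fin.
apply: lime_le.
  by apply: is_cvg_nneseries => l _ _; rewrite lee_fin mulr_ge0 ?exprn_ge0.
by apply: nearW => n; rewrite sumEFin lee_fin geometric_sum_le.
Qed.

Lemma iid_integral {R : realType} {d0 : measure_display} {Omega : measurableType d0}
    (P : probability Omega R) d (xi : 'I_d -> Omega -> R) (mu : probability R R)
    (f : R -> R) (e : R) (i : 'I_d) :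
  iid_with P xi mu -> measurable_fun setT f -> (forall x, 0 <= f x) ->
  (\int[mu]_x (f x)%:E = e%:E)%E -> (\int[P]_w (f (xi i w))%:E = e%:E)%E.
Proof.
move=> iid mf f0 fe.
have := @iid_integral_prod _ _ _ P d xi mu (fun j => if j == i then f else cst 1)
  (fun j => if j == i then e else 1) iid.
rewrite (bigD1 i) //= eqxx big1 ?mulr1; last by move=> j /negPf ->.
move=> <-.
- apply: eq_integral => w _; rewrite (bigD1 i) //= eqxx big1 ?mulr1 //.
  by move=> j /negPf ->.
- by move=> j; case: eqP.
- by move=> j x; case: eqP => //=.
- move=> j; case: eqP => // _.
  transitivity (1%:E * mu setT)%E; first exact: (integral_cst mu measurableT 1%:E).
  by rewrite probability_setT mule1.
Qed.

(** * Second moments of the sum of squares *)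

(** Expand the square as a double sum: the d diagonal terms have mean at most [kap], the d^2 - d
    others mean 1 by independence. *)
Lemma Ebound_iid_sum_sqr {R : realType} {d0 : measure_display} {Omega : measurableType d0}
    (P : probability Omega R) d (xi : 'I_d -> Omega -> R) (mu : probability R R) kap :
  iid_with P xi mu ->
  (\int[mu]_x (x ^+ 2)%:E = 1)%E -> Ebound mu (fun x => x ^+ 4) kap ->
  Ebound P (fun w => (\sum_(i < d) xi i w ^+ 2) ^+ 2) (d%:R * kap + d%:R ^+ 2 - d%:R).
Proof.
move=> iid h2 h4.
have E2 : Ebound mu (fun x => x ^+ 2) 1.
  by split; [exact: exprn_measurable|move=> w; exact: sqr_ge0|rewrite h2].
have := @Ebound_sum _ _ _ P _ (index_enum 'I_d) xpredT
  (fun i w => \sum_(j < d) xi i w ^+ 2 * xi j w ^+ 2)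
  (fun i => \sum_(j < d) if i == j then kap else 1).
have -> : (fun w => \sum_(i < d) \sum_(j < d) xi i w ^+ 2 * xi j w ^+ 2) =
   (fun w => (\sum_(i < d) xi i w ^+ 2) ^+ 2).
  by apply/funext => w; rewrite expr2 mulr_suml; apply: eq_bigr => i _; rewrite mulr_sumr.
have -> : \sum_(i < d) \sum_(j < d) (if i == j then kap else 1) =
   d%:R * kap + d%:R ^+ 2 - d%:R.
  rewrite (eq_bigr (fun=> kap + d%:R - 1)); last first.
    move=> i _; rewrite (bigD1 i) //= eqxx (eq_bigr (fun=> 1)); last first.
      by move=> j /negPf; rewrite eq_sym => ->.
    rewrite sumr_const cardC1 card_ord -addrA; congr (_ + _).
    by rewrite -subn1 natrB //; case: (i) => k; case: (d).
  by rewrite sumr_const card_ord -mulr_natl; ring.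
apply=> i _; apply: Ebound_sum => j _; case: (eqVneq i j) => [<-|ij].
  have := iid_Ebound i iid h4.
  by under eq_fun do rewrite (exprD _ 2 2).
have := iid_Ebound_prod_set [set i; j]%SET iid E2.
rewrite expr1n; under eq_fun do rewrite big_setU1 ?inE //= big_set1.
by [].
Qed.

(** A variance bound. The cross term enters with a minus sign, so the mean of the sum must be known
    exactly and not merely bounded. *)
Lemma Ebound_iid_dev {R : realType} {d0 : measure_display} {Omega : measurableType d0}
    (P : probability Omega R) d (xi : 'I_d -> Omega -> R) (mu : probability R R) kap :
  iid_with P xi mu ->
  (\int[mu]_x (x ^+ 2)%:E = 1)%E -> Ebound mu (fun x => x ^+ 4) kap ->
  Ebound P (fun w => (\sum_(i < d) xi i w ^+ 2 - d%:R) ^+ 2) (d%:R * kap).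
Proof.
move=> iid h2 h4.
have [ms s0 hs] := Ebound_iid_sum_sqr iid h2 h4.
have mxi i : measurable_fun setT (fun w => xi i w ^+ 2).
  by case: iid => mxi _; apply: measurable_funX.
have mS : measurable_fun setT (fun w => \sum_(i < d) xi i w ^+ 2).
  by apply: measurable_sum.
have S0 w : 0 <= \sum_(i < d) xi i w ^+ 2 by apply: sumr_ge0 => i _; exact: sqr_ge0.
have mX : measurable_fun setT (fun w => (\sum_(i < d) xi i w ^+ 2 - d%:R) ^+ 2).
  by apply: measurable_funX; apply: measurable_funB.
have intS : (\int[P]_w (\sum_(i < d) xi i w ^+ 2)%:E = d%:R%:E)%E.
  under eq_integral do rewrite -sumEFin.
  rewrite ge0_integral_sum //; last 2 first.
  - by move=> i; apply/measurable_EFinP.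
  - by move=> i w _; rewrite lee_fin sqr_ge0.
  rewrite (eq_bigr (fun=> 1%:E)) => [|i _].
    by rewrite sumEFin sumr_const card_ord.
  apply: (@iid_integral _ _ _ _ _ _ _ (fun x => x ^+ 2) 1 i iid) => //.
    by move=> x; exact: sqr_ge0.
(* The expansion of E(S - d)^2, with E S = d, written between sums of nonnegative integrals so that
   no difference of extended reals occurs. *)
have [X0 hX] : (forall w, 0 <= (\sum_(i < d) xi i w ^+ 2 - d%:R) ^+ 2) /\
  (\int[P]_w ((\sum_(i < d) xi i w ^+ 2 - d%:R) ^+ 2)%:E + (2 * d%:R * d%:R)%:E =
   \int[P]_w ((\sum_(i < d) xi i w ^+ 2) ^+ 2)%:E + (d%:R ^+ 2)%:E)%E.
  split; first by move=> w; exact: sqr_ge0.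
  have [_ _ hc] := @Ebound_cst R _ Omega P (d%:R ^+ 2) (sqr_ge0 _).
  rewrite EFinM -intS -ge0_integralZl_EFin //; last 2 first.
  - by move=> w _; rewrite lee_fin.
  - exact/measurable_EFinP.
  have -> : ((d%:R ^+ 2)%:E = \int[P]_w (cst (d%:R ^+ 2 : R) w)%:E)%E.
    transitivity ((d%:R ^+ 2)%:E * P setT)%E; first by rewrite probability_setT mule1.
    by apply/esym; exact: (integral_cst P measurableT (d%:R ^+ 2)%:E).
  have mS2 : measurable_fun setT (fun w => (\sum_(i < d) xi i w ^+ 2) ^+ 2).
    by apply: measurable_funX.
  rewrite -!ge0_integralD //.
  - by apply: eq_integral => w _; rewrite -EFinM -!EFinD /cst; congr (_%:E); ring.
  all: try by [apply/measurable_EFinP|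
    move=> w _; rewrite ?mule_ge0 // lee_fin ?mulr_ge0 // sqr_ge0].
    by move=> w _; rewrite lee_fin sqr_ge0.
  by under eq_fun do rewrite -EFinM; apply/measurable_EFinP; exact: measurable_funM.
split => //.
have [y /andP[y0 hy] ey] := Ebound_integral (Ebound_iid_sum_sqr iid h2 h4).
move: hX; rewrite ey; case: (integral P _ _) => [x [hxy]|//|//].
by rewrite lee_fin; have := ler0n R d; lra.
Qed.

(** * Products of excesses over a level *)

(** Squared size in units of the level: zero up to [t] and above 1 beyond it. A product of [r]
    excesses is thus nonzero only when all [r] entries exceed the level. *)
Definition excess {R : realType} (t x : R) : R := (x / t) ^+ 2 * (t < `|x|)%R%:R.

Lemma excess_ge0 {R : realType} (t x : R) : 0 <= excess t x.
Proof. by rewrite mulr_ge0 ?sqr_ge0. Qed.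

(* If [r] entries dominate an entry above the level [t], the product over those [r]
   entries of the (at least one) excesses controls the square of that entry. *)
Lemma sqr_le_excess_prod {R : realType} d (z : 'I_d -> R) (t : R) (k : 'I_d) r :
  0 < t -> (0 < r)%N -> (r <= #|[set i | (`|z k| <= `|z i|)%R]%SET|)%N ->
  (t < `|z k|)%R%:R * z k ^+ 2 <=
  t ^+ 2 * \sum_(A : {set 'I_d} | #|A| == r) \prod_(i in A) excess t (z i).
Proof.
move=> t0 r0 /card_geqP[l [ul sl hl]].
have S0 : 0 <= \sum_(A : {set 'I_d} | #|A| == r) \prod_(i in A) excess t (z i).
  by apply: sumr_ge0 => A _; apply: prodr_ge0 => i _; exact: excess_ge0.
case: ltP => [tz|_]; last by rewrite mul0r mulr_ge0 // sqr_ge0.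
rewrite mul1r.
have cl : #|[set i in l]%SET| == r by rewrite cardsE (card_uniqP ul) sl.
rewrite (bigD1 [set i in l]%SET) //= mulrDr.
apply: (@le_trans _ _ (t ^+ 2 * \prod_(i in [set i in l]%SET) excess t (z i))); last first.
  rewrite lerDl mulr_ge0 ?sqr_ge0 //; apply: sumr_ge0 => A _; apply: prodr_ge0 => i _.
  exact: excess_ge0.
(* Every factor is at least [q], and q <= q^r because q >= 1 and r > 0. *)
set q := (`|z k| / t) ^+ 2.
have q1 : 1 <= q by rewrite /q exprn_ege1 // ler_pdivlMr // mul1r ltW.
apply: (@le_trans _ _ (t ^+ 2 * q)).
  by rewrite /q expr_div_n mulrC divfK ?expf_neq0 ?gt_eqF // real_normK ?num_real.
rewrite ler_pM2l ?exprn_gt0 //.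
apply: (@le_trans _ _ (\prod_(i in [set i in l]%SET) q)).
  rewrite prodr_const (eqP cl); case: r r0 {sl cl S0} => // r _.
  rewrite exprS ler_peMr //; first by rewrite (le_trans ler01 q1).
  exact: exprn_ege1.
apply: ler_prod => i; rewrite inE => /hl; rewrite inE => hi.
rewrite (le_trans ler01 q1) /= /excess (lt_le_trans tz hi) mulr1 /q.
rewrite -[leRHS]real_normK ?num_real // normrM normfV (gtr0_norm t0).
rewrite lerXn2r ?nnegrE ?divr_ge0 ?(ltW t0) //.
by rewrite ler_pM2r ?invr_gt0.
Qed.

(** The falling factorial is at most n^r, and r^r <= r! e^r follows by induction from (1 + 1/r)^r <=
    e. *)
Lemma bin_expR_le {R : realType} n r : (0 < r)%N ->
  ('C(n, r))%:R <= (expR 1 * n%:R / r%:R) ^+ r :> R.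
Proof.
move=> r0; have fact_ge : r%:R ^+ r <= r`!%:R * expR r%:R :> R.
  elim: r r0 => // -[|r] IH _.
    have -> : 1`! = 1%N by [].
    by rewrite expr1 mul1r (le_trans _ (expR_ge1Dx _)) // lerDr.
  have {}IH := IH isT.
  have e1 : r.+2%:R ^+ r.+1 <= expR 1 * r.+1%:R ^+ r.+1 :> R.
    have -> : r.+2%:R = (1 + r.+1%:R^-1) * r.+1%:R :> R.
      by rewrite mulrDl mulVf ?mul1r ?pnatr_eq0 // -natr1.
    rewrite exprMn ler_wpM2r ?exprn_ge0 //.
    apply: (@le_trans _ _ (expR r.+1%:R^-1 ^+ r.+1)).
      by rewrite lerXn2r ?nnegrE ?expR_ge0 ?addr_ge0 ?invr_ge0 // expR_ge1Dx.
    by rewrite -expRM_natl -mulr_natl mulfV ?pnatr_eq0.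
  rewrite exprS factS natrM -mulrA ler_wpM2l //.
  apply: (le_trans e1).
  have -> : expR r.+2%:R = expR 1 * expR r.+1%:R :> R by rewrite -expRD -[in LHS]natr1 addrC.
  by rewrite mulrCA ler_wpM2l ?expR_ge0.
have r0' : 0 < r%:R :> R by rewrite ltr0n.
have f0 : 0 < r`!%:R :> R by rewrite ltr0n fact_gt0.
rewrite -(ler_pM2r f0) -natrM bin_ffact.
apply: (@le_trans _ _ (n%:R ^+ r)).
  rewrite -natrX ler_nat; elim: r {fact_ge r0 r0' f0} n => [|r IH] n.
    by rewrite ffactn0.
  by rewrite ffactnSr expnSr leq_mul ?IH ?leq_subr.
have -> : (expR 1 * n%:R / r%:R) ^+ r = n%:R ^+ r * (expR r%:R / r%:R ^+ r) :> R.
  by rewrite !exprMn exprVn -expRM_natl mulr1 mulrAC mulrC.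
rewrite -mulrA ler_peMr ?exprn_ge0 // mulrAC ler_pdivlMr ?exprn_gt0 //.
by rewrite mul1r mulrC.
Qed.

(** By independence the mean is at most C(d, r) g^r <= (e d g / r)^r, and the base is at most 1/2.
    The geometric decay in [r] makes the sum over positions converge. *)
Lemma Ebound_excess_sum {R : realType} {d0 : measure_display} {Omega : measurableType d0}
    (P : probability Omega R) d (xi : 'I_d -> Omega -> R) (mu : probability R R) t g r :
  iid_with P xi mu -> (0 < r)%N -> 0 <= g -> Ebound mu (excess t) g ->
  expR 1 * d%:R * g <= r%:R / 2 ->
  Ebound P (fun w => \sum_(A : {set 'I_d} | #|A| == r) \prod_(i in A) excess t (xi i w))
    (2^-1 ^+ r).
Proof.
move=> iid r0 g0 hg small.
have r0' : 0 < r%:R :> R by rewrite ltr0n.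
apply: (@Ebound_le _ _ _ _ _ (('C(d, r))%:R * g ^+ r)).
  apply: (@le_trans _ _ ((expR 1 * d%:R / r%:R) ^+ r * g ^+ r)).
    by rewrite ler_wpM2r ?exprn_ge0 // bin_expR_le.
  rewrite -exprMn lerXn2r ?nnegrE ?mulr_ge0 ?invr_ge0 ?expR_ge0 //.
  by rewrite mulrAC ler_pdivrMr // [leRHS]mulrC.
have := @Ebound_sum _ _ _ P _ (index_enum {set 'I_d}) (fun A => #|A| == r)
  (fun A w => \prod_(i in A) excess t (xi i w)) (fun A => g ^+ #|A|).
have -> : \sum_(A : {set 'I_d} | #|A| == r) g ^+ #|A| = ('C(d, r))%:R * g ^+ r.
  rewrite (eq_bigr (fun=> g ^+ r)); last by move=> A /eqP ->.
  have -> : 'C(d, r) = #|[set A : {set 'I_d} | #|A| == r]%SET|.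
    by rewrite card_draws card_ord.
  rewrite sumr_const -[LHS]mulr_natl; congr (_%:R * _).
  by apply: eq_card => A; rewrite inE.
by apply=> A _; exact: (iid_Ebound_prod_set A iid hg).
Qed.

(** * Median of means: clean blocks and pointwise bounds *)

(** With h = (m-1) %/ 2 the sorted list has h+1 entries up to the median and m-h from it on; each
    number is at least m/2 for either parity of [m]. *)
Lemma median_card {R : realType} m (x : 'I_m -> R) : (0 < m)%N ->
  [/\ exists i, median x = x i,
    (m <= 2 * #|[set i | (x i <= median x)%R]%SET|)%N &
    (m <= 2 * #|[set i | (median x <= x i)%R]%SET|)%N].
Proof.
move=> m0.
have [||p pinj hp] := @sorting_injection m (fun i j => x i <= x j).
- by move=> i j; exact: le_total.
- by move=> j i k; exact: le_trans.
have km : (m.-1 %/ 2 < m)%N by rewrite ltn_divLR //; lia.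
pose k := Ordinal km.
have medE : median x = x (p k).
  rewrite /median (@sort_map_inj _ <=%R _ x p) //.
  - by rewrite (nth_map k) ?size_enum_ord // (nth_ord_enum k k).
  - exact: le_total.
  - exact: le_trans.
  - exact: le_anti.
have hk : (val k <= (m - 1) %/ 2)%N by rewrite /= subn1.
split; first by exists (p k).
- apply: (@leq_trans (2 * #|[set p j | j : 'I_m & (j <= k)%N]%SET|)).
    rewrite card_imset // (card_ord_lt (ltn_ord k)) /=; lia.
  rewrite leq_mul2l /=; apply/subset_leq_card/fintype.subsetP => i /imsetP[j].
  by rewrite !inE => jk ->; rewrite medE; exact: hp.
- apply: (@leq_trans (2 * #|[set p j | j : 'I_m & ~~ (j < k)%N]%SET|)).
    rewrite card_imset //.
    have := cardsC [set j : 'I_m | (j < k)%N]%SET.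
    rewrite (card_ord_lt (ltnW km)) card_ord.
    have -> : (~: [set j : 'I_m | (j < k)%N])%SET = [set j : 'I_m | ~~ (j < k)%N]%SET.
      by apply/setP => j; rewrite !inE.
    move=> /= ?; lia.
  rewrite leq_mul2l /=; apply/subset_leq_card/fintype.subsetP => i /imsetP[j].
  by rewrite !inE -leqNgt => kj ->; rewrite medE; exact: hp.
Qed.

(** Recasts the partition as a labelling of coordinates by blocks, the form needed to regroup sums
    by block. *)
Lemma block_partitionP d m (B : 'I_m -> {set 'I_d}) : is_block_partition B ->
  exists2 blk : 'I_d -> 'I_m, forall b j, (j \in B b) = (blk j == b) &
    forall b, (d %/ m <= #|B b|)%N.
Proof.
move=> [disj [cov sz]].
have /choice[blk hblk] := cov.
exists blk => // b j; apply/idP/eqP => [jb|<-]; last exact: hblk.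
apply/eqP/negPn/negP => ne; have := disj _ _ ne.
by move/setP => /(_ j); rewrite !inE hblk jb.
Qed.

(** The remainder of d by m is below m, hence below m (d %/ m): rounding costs at most a factor
    2. *)
Lemma leq_double_div d m : (0 < m)%N -> (m <= d)%N -> (d <= 2 * (m * (d %/ m)))%N.
Proof.
move=> m0 md; have := divn_eq d m; have := @ltn_pmod d m m0.
have : (0 < d %/ m)%N by rewrite divn_gt0.
by nia.
Qed.

Lemma leq_block_union d m q w u :
  (d <= 2 * (m * q))%N -> (m < 4 * w)%N -> (w * q <= u)%N -> (d <= 8 * u)%N.
Proof. by nia. Qed.

Section Blocks.
Context {R : realType}.
Variables (d m s : nat) (B : 'I_m -> {set 'I_d}) (th z : 'I_d -> R) (sig : R).
Hypotheses (partB : is_block_partition B) (md : (m <= d)%N) (sm : (4 * s < m)%N)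
  (sth : in_Theta s th) (sig0 : 0 < sig).

Let y i := th i + sig * z i.
Let x b := (#|B b|%:R)^-1 * \sum_(j in B b) y j ^+ 2.

(** The support meets at most s < m/4 blocks, so any half of the blocks keeps more than m/4 blocks
    free of signal. *)
Lemma clean_blocks (blk : 'I_d -> 'I_m) (L : {set 'I_m}) :
  (m <= 2 * #|L|)%N ->
  (m < 4 * #|L :\: [set blk j | j : 'I_d & th j != 0%R]|)%N.
Proof.
move=> mL; rewrite cardsD.
have : (#|(L :&: [set blk j | j : 'I_d & th j != 0%R])%SET| <= s)%N.
  apply: leq_trans (subset_leq_card (finset.subsetIr _ _)) _.
  by apply: leq_trans (leq_imset_card _ _) _; move: sth; rewrite in_ThetaE.
move=> h; lia.
Qed.

Lemma clean_block_mean (blk : 'I_d -> 'I_m) b :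
  (forall b j, (j \in B b) = (blk j == b)) ->
  b \notin [set blk j | j : 'I_d & th j != 0%R]%SET ->
  x b = sig ^+ 2 * ((#|B b|%:R)^-1 * \sum_(j | blk j == b) z j ^+ 2).
Proof.
move=> hblk hb; rewrite mulrCA /x; congr (_ * _); rewrite mulr_sumr.
apply: eq_big => [j|j]; first by rewrite hblk.
rewrite hblk => /eqP jb; rewrite /y; suff -> : th j = 0 by rewrite add0r exprMn.
by apply/eqP/negPn/negP => thj; move/negP: hb; apply; apply/imsetP; exists j; rewrite ?inE.
Qed.

Let m0 : (0 < m)%N.
Proof. exact: leq_ltn_trans (leq0n _) sm. Qed.

Let divpos : (0 < d %/ m)%N.
Proof. by rewrite divn_gt0. Qed.

Let ddiv : (d <= 2 * (m * (d %/ m)))%N.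
Proof. exact: leq_double_div. Qed.

Lemma mom_sigma_sqr : mom_sigma B y ^+ 2 = median x.
Proof.
rewrite sqr_sqrtr //; have [[i ->] _ _] := @median_card R m x m0.
by rewrite mulr_ge0 ?invr_ge0 ?ler0n // sumr_ge0 // => j _; exact: sqr_ge0.
Qed.

(** More than m/4 clean blocks have a mean no smaller than the median, and together their noise
    energy is at most the total. The constant is 8 = 2 * 4: a factor 2 from the block size and 4
    from the proportion of blocks. *)
Lemma mom_sigma_upper :
  mom_sigma B y ^+ 2 <= 8 * sig ^+ 2 * (d%:R^-1 * \sum_(i < d) z i ^+ 2).
Proof.
have [blk hblk sz] := block_partitionP partB.
rewrite mom_sigma_sqr; set med := median x.
have [_ _ hcard] := @median_card R m x m0.
have := clean_blocks blk hcard.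
set H := (_ :\: _)%SET => hH.
set S := \sum_(i < d) _.
have S0 : 0 <= S by apply: sumr_ge0 => i _; exact: sqr_ge0.
have q0 : 0 < (d %/ m)%:R :> R by rewrite ltr0n.
have main : #|H|%:R * med <= sig ^+ 2 * ((d %/ m)%:R^-1 * S).
  have -> : #|H|%:R * med = \sum_(b in H) med by rewrite sumr_const mulr_natl.
  apply: (@le_trans _ _ (\sum_(b in H) sig ^+ 2 * ((d %/ m)%:R^-1 * \sum_(j | blk j == b) z j ^+ 2))).
    apply: ler_sum => b; rewrite !inE => /andP[bT].
    move=> /le_trans; apply; rewrite (clean_block_mean hblk bT).
    rewrite ler_wpM2l ?sqr_ge0 // ler_wpM2r //.
      by apply: sumr_ge0 => j _; exact: sqr_ge0.
    by rewrite lef_pV2 ?posrE ?ltr0n ?ler_nat // (leq_trans divpos).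
  rewrite -!mulr_sumr; apply: ler_wpM2l; first exact: sqr_ge0.
  apply: ler_wpM2l; first by rewrite invr_ge0 ler0n.
  rewrite /S (partition_big blk xpredT) //= big_mkcond; apply: ler_sum => b _.
  by case: ifP => // _; apply: sumr_ge0 => j _; exact: sqr_ge0.
have med0 : 0 <= med by rewrite /med -mom_sigma_sqr sqr_ge0.
have d0 : 0 < d%:R :> R by rewrite ltr0n (leq_trans m0 md).
have h4 : m%:R <= 4 * #|H|%:R :> R by rewrite -natrM ler_nat ltnW.
have h2 : d%:R <= 2 * (m%:R * (d %/ m)%:R) :> R by rewrite -!natrM ler_nat.
rewrite -(ler_pM2l d0) mulrCA mulVKf ?gt_eqF //.
have main' : (d %/ m)%:R * (#|H|%:R * med) <= sig ^+ 2 * S.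
  by rewrite -(ler_pM2l q0) [leRHS]mulrCA mulVKf ?gt_eqF // in main.
apply: (@le_trans _ _ (2 * (m%:R * (d %/ m)%:R) * med)); first by rewrite ler_wpM2r.
apply: (@le_trans _ _ (8 * ((d %/ m)%:R * (#|H|%:R * med)))).
  have : (d %/ m)%:R * med * m%:R <= (d %/ m)%:R * med * (4 * #|H|%:R).
    by rewrite ler_wpM2l // mulr_ge0 // ltW.
  lra.
lra.
Qed.

(** A union bound in pointwise form. If the estimate is below sig/2, more than m/4 clean blocks have
    mean at most sig^2/4; on their union the sum of 1/4 - z_j^2 is nonnegative, so the corresponding
    product of exponentials is at least 1. *)
Lemma mom_sigma_lower (blk : 'I_d -> 'I_m) (a : R) :
  (forall b j, (j \in B b) = (blk j == b)) -> 0 <= a ->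
  (mom_sigma B y < sig / 2)%R%:R <=
  \sum_(W : {set 'I_m} | (m < 4 * #|W|)%N)
    \prod_(j in [set j | blk j \in W]%SET) expR (a * (4^-1 - z j ^+ 2)).
Proof.
move=> hblk a0.
have sz := proj2 (proj2 partB).
have S0 : 0 <= \sum_(W : {set 'I_m} | (m < 4 * #|W|)%N)
    \prod_(j in [set j | blk j \in W]%SET) expR (a * (4^-1 - z j ^+ 2)).
  by apply: sumr_ge0 => W _; apply: prodr_ge0 => j _; exact: expR_ge0.
case: ltP => // hbad.
have [_ hcard _] := @median_card R m x m0.
have := clean_blocks blk hcard.
set W := (_ :\: _)%SET => hW.
rewrite (bigD1 W) //=; apply: ler_wpDr.
  by apply: sumr_ge0 => V _; apply: prodr_ge0 => j _; exact: expR_ge0.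
rewrite -expR_sum -[X in X <= _](@expR0 R) ler_expR -mulr_sumr mulr_ge0 //.
rewrite (partition_big blk (mem W)) /=; last by move=> j; rewrite inE.
apply: sumr_ge0 => b bW.
rewrite (eq_bigl (fun j => blk j == b)); last first.
  by move=> j; rewrite inE; case: eqP => [->|]; rewrite ?bW ?andbF.
move: (bW); rewrite !inE => /andP[bT xb].
have hx : x b <= sig ^+ 2 * 4^-1.
  apply: (le_trans xb); rewrite -mom_sigma_sqr.
  have mom0 : 0 <= mom_sigma B y by exact: sqrtr_ge0.
  have : mom_sigma B y ^+ 2 <= (sig / 2) ^+ 2 by rewrite lerXn2r ?nnegrE ?(ltW hbad) // divr_ge0 ?ltW.
  by move/le_trans; apply; rewrite le_eqVlt; apply/orP; left; apply/eqP; field.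
have cB : #|B b| = #|[pred j | blk j == b]| by apply: eq_card => j; rewrite inE hblk.
have Bpos : 0 < #|B b|%:R :> R by rewrite ltr0n (leq_trans divpos).
move: hx; rewrite (clean_block_mean hblk bT) ler_pM2l ?exprn_gt0 //.
rewrite mulrC ler_pdivrMr // sumrB sumr_const -cB subr_ge0 => /le_trans; apply.
by rewrite mulr_natr.
Qed.

Lemma card_block_union (blk : 'I_d -> 'I_m) (W : {set 'I_m}) :
  (forall b j, (j \in B b) = (blk j == b)) -> (m < 4 * #|W|)%N ->
  (d <= 8 * #|[set j | blk j \in W]%SET|)%N.
Proof.
move=> hblk hW; have sz := proj2 (proj2 partB).
have : (#|W| * (d %/ m) <= #|[set j | blk j \in W]%SET|)%N.
  rewrite -[leqRHS]sum1_card (partition_big blk (mem W)) /=; last by move=> j; rewrite inE.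
  rewrite -sum_nat_const; apply: leq_sum => b bW.
  rewrite sum1_card; apply: leq_trans (sz b) _.
  rewrite leq_eqVlt; apply/orP; left; apply/eqP/eq_card => j.
  rewrite hblk; change ((blk j == b) = (j \in [set j | blk j \in W]%SET) && (blk j == b)).
  by rewrite inE; case: eqP => [->|]; rewrite ?bW ?andbF.
by move=> h; apply: (leq_block_union ddiv hW h).
Qed.

End Blocks.

(** * Weights of controlled decay *)

Lemma sum_inv_sqrt_le {R : realType} s :
  \sum_(k < s) (Num.sqrt k.+1%:R)^-1 <= 2 * Num.sqrt s%:R :> R.
Proof.
elim: s => [|s IH]; first by rewrite big_ord0 sqrtr0 mulr0.
rewrite big_ord_recr /=; apply: le_trans (lerD IH (lexx _)) _.
have b0 : 0 < Num.sqrt s.+1%:R :> R by rewrite sqrtr_gt0.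
have a2 : Num.sqrt s%:R ^+ 2 = s%:R :> R by rewrite sqr_sqrtr.
have b2 : Num.sqrt s.+1%:R ^+ 2 = Num.sqrt s%:R ^+ 2 + 1 :> R.
  by rewrite a2 sqr_sqrtr // natr1.
(* With b^2 - a^2 = 1, the increment bound 1/b <= 2 (b - a) is equivalent to (b - a)^2 >= 0. *)
move: (Num.sqrt s.+1%:R) (Num.sqrt s%:R) b0 b2 {a2 IH} => b a b0 b2.
rewrite -(ler_pM2r b0) mulrDl mulVf ?gt_eqF // -!mulrA -expr2 b2.
rewrite -subr_ge0 (_ : _ - _ = (b - a) ^+ 2 - (b ^+ 2 - (a ^+ 2 + 1))); last by ring.
by rewrite b2 subrr subr0 sqr_ge0.
Qed.

Section Regular.
Context {R : realType}.
Variables (d s : nat) (lam : nat -> R) (C1 : R).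
Hypotheses (C11 : 1 <= C1) (s0 : (0 < s)%N) (sd : (s <= d)%N)
  (lam0 : forall i, (0 < i <= d)%N -> 0 < lam i)
  (lamreg : forall j k, (0 < j)%N -> (j <= k <= d)%N ->
    lam j ^+ 2 <= C1 * lam k ^+ 2 * Num.sqrt (k%:R / j%:R)).

(** Regularity gives lam_k^2 <= C1 lam_s^2 sqrt(s/k), and the inverse square roots up to [s] sum to
    at most 2 sqrt(s): the whole sum is of the order of [s] times its last term. *)
Lemma sum_sqr_regular_le :
  \sum_(k < d) (k < s)%N%:R * lam k.+1 ^+ 2 <= 2 * C1 * (s%:R * lam s ^+ 2).
Proof.
have -> : \sum_(k < d) (k < s)%N%:R * lam k.+1 ^+ 2 = \sum_(k < s) lam k.+1 ^+ 2.
  rewrite (big_ord_widen _ (fun k => lam k.+1 ^+ 2) sd) [RHS]big_mkcond.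
  by apply: eq_bigr => k _; case: ifP; rewrite ?mul1r ?mul0r.
apply: (@le_trans _ _ (\sum_(k < s) C1 * lam s ^+ 2 * Num.sqrt s%:R * (Num.sqrt k.+1%:R)^-1)).
  apply: ler_sum => k _; rewrite -mulrA -sqrtrV ?ler0n // -sqrtrM ?ler0n //.
  by apply: lamreg => //; rewrite ltn_ord.
rewrite -mulr_sumr; apply: (@le_trans _ _ (C1 * lam s ^+ 2 * Num.sqrt s%:R * (2 * Num.sqrt s%:R))).
  rewrite ler_wpM2l ?sum_inv_sqrt_le // mulr_ge0 ?sqrtr_ge0 // mulr_ge0 ?sqr_ge0 //.
  exact: le_trans ler01 C11.
have e : Num.sqrt s%:R ^+ 2 = s%:R :> R by rewrite sqr_sqrtr.
by rewrite -[in leRHS]e le_eqVlt; apply/orP; left; apply/eqP; ring.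
Qed.

(** Since sqrt(k/r) <= 2, regularity gives lam_r <= 2 C1 lam_k. This is the source of the level
    lam_r / (16 C1): noise above lam_k / 8 also exceeds the level of any rank [r] with r <= k <=
    2r. *)
Lemma regular_double r k : (0 < r)%N -> (r <= k <= d)%N -> (k <= 2 * r)%N ->
  lam r / (16 * C1) <= lam k / 8.
Proof.
move=> r0 /andP[rk kd] k2r.
have k0 : (0 < k)%N by exact: leq_trans rk.
have lr : 0 < lam r by apply: lam0; rewrite r0 (leq_trans rk).
have lk : 0 < lam k by apply: lam0; rewrite k0.
have C0 : 0 < C1 by exact: lt_le_trans C11.
have h : lam r ^+ 2 <= (2 * C1 * lam k) ^+ 2.
  apply: (le_trans (lamreg r0 (_ : (r <= k <= d)%N))); first by rewrite rk kd.
  have sq : Num.sqrt (k%:R / r%:R) <= 2 :> R.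
    rewrite -[leRHS](@ger0_norm R 2) // -sqrtr_sqr ler_wsqrtr // ler_pdivrMr ?ltr0n //.
    by rewrite -natrX -natrM ler_nat (leq_trans k2r) // leq_mul2r orbT.
  apply: (@le_trans _ _ (C1 * lam k ^+ 2 * 2)).
    by rewrite ler_wpM2l // mulr_ge0 ?sqr_ge0 // ltW.
  rewrite -subr_ge0 (_ : _ - _ = C1 * lam k ^+ 2 * (4 * C1 - 2)); last by ring.
  apply: mulr_ge0; first by rewrite mulr_ge0 ?sqr_ge0 // ltW.
  by have := C11; lra.
have : lam r <= 2 * C1 * lam k.
  by rewrite -(@ler_pXn2r _ 2) ?nnegrE ?(ltW lr) // !mulr_ge0 ?ltW.
move=> h2; rewrite ler_pdivrMr ?mulr_gt0 //.
by apply: (le_trans h2); rewrite le_eqVlt; apply/orP; left; apply/eqP; field.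
Qed.

End Regular.

(** * Exponential bound for the probability that the scale is underestimated *)

(** Because (1 - y + y^2)(1 + y) = 1 + y^3 >= 1 and 1 + y <= e^y. *)
Lemma expRN_le {R : realType} (y : R) : 0 <= y -> expR (- y) <= 1 - y + y ^+ 2.
Proof.
move=> y0; rewrite expRN -div1r ler_pdivrMr ?expR_gt0 //.
apply: (@le_trans _ _ ((1 - y + y ^+ 2) * (1 + y))).
  rewrite -subr_ge0 (_ : _ - _ = y ^+ 3); last by ring.
  by rewrite exprn_ge0.
rewrite ler_wpM2l ?expR_ge1Dx //.
rewrite (_ : _ + _ = (y - 2^-1) ^+ 2 + 3 / 4); last by field.
by rewrite addr_ge0 ?sqr_ge0.
Qed.

(* Chernoff bound for the lower tail of sums of squares. *)
Lemma Ebound_exp_sqr {R : realType} (mu : probability R R) (kap : R) :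
  1 <= kap -> (\int[mu]_x (x ^+ 2)%:E = 1)%E -> Ebound mu (fun x => x ^+ 4) kap ->
  Ebound mu (fun x => expR ((2 * kap)^-1 * (4^-1 - x ^+ 2))) (expR (- (8 * kap)^-1)).
Proof.
(* This [a] makes the quadratic term a^2 kap equal to a/2, so the mean of exp(-a x^2) is at most 1 -
   a/2; with the factor exp(a/4) the exponent becomes -a/4 = -1/(8 kap). *)
move=> k1 h2 h4; set a := (2 * kap)^-1.
have k0 : 0 < kap by exact: lt_le_trans k1.
have a0 : 0 < a by rewrite invr_gt0 mulr_gt0.
have mf : measurable_fun setT (fun x : R => expR (- (a * x ^+ 2))).
  apply: measurableT_comp; first exact: measurable_expR.
  apply: measurableT_comp => //; apply: measurable_funM => //.
have h : Ebound mu (fun x => expR (- (a * x ^+ 2))) (1 - a / 2).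
  split => //.
  have [_ _] := Ebound_add (@Ebound_cst _ _ _ mu 1 ler01) (Ebound_scale (sqr_ge0 a) h4).
  have : (\int[mu]_x (expR (- (a * x ^+ 2)))%:E + a%:E * \int[mu]_x (x ^+ 2)%:E
      <= \int[mu]_x (cst 1 x + a ^+ 2 * x ^+ 4)%:E)%E.
    rewrite -ge0_integralZl_EFin ?(ltW a0) //; last 2 first.
    - by move=> x _; rewrite lee_fin sqr_ge0.
    - by apply/measurable_EFinP; exact: exprn_measurable.
    rewrite -ge0_integralD //.
    all: try by [apply/measurable_EFinP|move=> x _; rewrite ?mule_ge0 // lee_fin ?sqr_ge0 // ltW].
    all: try by (under eq_fun do rewrite -EFinM; apply/measurable_EFinP;
      apply: measurable_funM => //; exact: exprn_measurable).
    apply: ge0_integral_le_nomeas => x.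
      by rewrite adde_ge0 // ?mule_ge0 // lee_fin ?expR_ge0 ?sqr_ge0 // ltW.
    rewrite -EFinM -EFinD lee_fin.
    have /expRN_le : 0 <= a * x ^+ 2 by rewrite mulr_ge0 ?sqr_ge0 // ltW.
    by rewrite /cst exprMn -exprM; lra.
  rewrite h2 mule1 => h5 h6; have := le_trans h5 h6.
  rewrite -leeBrDr // -EFinB => /le_trans; apply; rewrite lee_fin.
  have ak : a * kap = 2^-1 by rewrite /a invfM -mulrA mulVf ?mulr1 // gt_eqF.
  have -> : a ^+ 2 * kap = a / 2 by rewrite expr2 -mulrA ak.
  lra.
have := Ebound_scale (expR_ge0 (a / 4)) h.
under eq_fun do rewrite -expRD.
have -> : (fun x : R => expR (a / 4 + - (a * x ^+ 2))) = (fun x => expR (a * (4^-1 - x ^+ 2))).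
  by apply/funext => x; rewrite mulrBr.
apply: Ebound_le.
apply: (@le_trans _ _ (expR (a / 4) * expR (- (a / 2)))).
  by rewrite ler_wpM2l ?expR_ge0 // expR_ge1Dx.
rewrite -expRD ler_expR le_eqVlt; apply/orP; left; apply/eqP.
by rewrite /a; field; rewrite gt_eqF.
Qed.

(** At most 2^m <= e^m sets of blocks occur; each covers at least d/8 coordinates and so contributes
    at most exp(-d/(64 kap)). The condition m <= d/(128 kap) leaves exp(-d/(128 kap)) <= 128
    kap/d. *)
Lemma Ebound_bad_blocks {R : realType} {d0 : measure_display} {Omega : measurableType d0}
    (P : probability Omega R) (d m : nat) (xi : 'I_d -> Omega -> R) (mu : probability R R)
    (B : 'I_m -> {set 'I_d}) (blk : 'I_d -> 'I_m) (kap : R) :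
  iid_with P xi mu -> is_block_partition B -> (0 < m)%N -> (m <= d)%N ->
  (forall b j, (j \in B b) = (blk j == b)) ->
  1 <= kap -> m%:R <= d%:R / (128 * kap) ->
  (\int[mu]_x (x ^+ 2)%:E = 1)%E -> Ebound mu (fun x => x ^+ 4) kap ->
  Ebound P (fun w => \sum_(W : {set 'I_m} | (m < 4 * #|W|)%N)
    \prod_(j in [set j | blk j \in W]%SET) expR ((2 * kap)^-1 * (4^-1 - xi j w ^+ 2)))
  (128 * kap / d%:R).
Proof.
move=> iid partB m0 md hblk k1 mk h2 h4.
have k0 : 0 < kap by exact: lt_le_trans k1.
have hd0 : 0 < d%:R :> R by rewrite ltr0n (leq_trans m0).
have he := Ebound_exp_sqr k1 h2 h4.
apply: (@Ebound_le _ _ _ _ _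
   (\sum_(W : {set 'I_m} | (m < 4 * #|W|)%N) expR (- (d%:R / (64 * kap))))); last first.
  apply: Ebound_sum => W hW.
  have := iid_Ebound_prod_set [set j | blk j \in W]%SET iid he.
  apply: Ebound_le; rewrite -expRM_natl ler_expR mulrN lerN2.
  have := card_block_union partB md (m0 : (4 * 0 < m)%N) hblk hW.
  rewrite -(@ler_nat R) natrM => hU.
  apply: (@le_trans _ _ (8 * #|[set j | blk j \in W]%SET|%:R / (64 * kap))).
    by rewrite ler_wpM2r ?invr_ge0 ?mulr_ge0 ?(ltW k0).
  by rewrite le_eqVlt; apply/orP; left; apply/eqP; field; rewrite gt_eqF.
rewrite sumr_const.
set N := #|_|.
have N2 : N%:R <= expR m%:R :> R.
  apply: (@le_trans _ _ (2 ^+ m)).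
    rewrite -natrX ler_nat; apply: leq_trans (max_card _) _.
    by rewrite -cardsT -powersetT card_powerset cardsT card_ord.
  rewrite -[m%:R]mulr1 expRM_natl lerXn2r ?nnegrE ?expR_ge0 //.
  exact: expR_ge1Dx.
rewrite -[leLHS]mulr_natl.
apply: (@le_trans _ _ (expR (d%:R / (128 * kap)) * expR (- (d%:R / (64 * kap))))).
  by rewrite ler_wpM2r ?expR_ge0 // (le_trans N2) // ler_expR.
rewrite -expRD (_ : _ + _ = - (d%:R / (128 * kap))); last first.
  by field; rewrite gt_eqF.
rewrite expRN -[leRHS]invf_div lef_pV2 ?posrE ?expR_gt0 ?divr_gt0 ?mulr_gt0 //.
by apply: le_trans (expR_ge1Dx _); rewrite lerDr.
Qed.

(** * Pointwise bound on the loss *)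

Lemma amgm {R : realType} (q x : R) : 0 < q -> 2 * x <= q + q^-1 * x ^+ 2.
Proof.
move=> q0; rewrite -(ler_pM2l q0) mulrDr mulVKf ?gt_eqF // -subr_ge0.
rewrite (_ : _ - _ = (q - x) ^+ 2); last by ring.
exact: sqr_ge0.
Qed.

Lemma sqr_le_excess {R : realType} (t x : R) : 0 < t -> x ^+ 2 <= t ^+ 2 + t ^+ 2 * excess t x.
Proof.
move=> t0; rewrite /excess; case: ltP => [_|xt].
  rewrite mulr1 expr_div_n mulrC divfK ?expf_neq0 ?gt_eqF //.
  by rewrite lerDr sqr_ge0.
by rewrite mulr0 mulr0 addr0 -[x ^+ 2]real_normK ?num_real // lerXn2r ?nnegrE ?(ltW t0).
Qed.

(** The reason for a head of 2s positions: beyond it the rank k+1-s, which remains after discarding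
    the support, is at least half of k+1, and [regular_double] applies. *)
Lemma ltn_double_sub k s : (2 * s <= k)%N -> (k < 2 * (k.+1 - s))%N.
Proof. by lia. Qed.

Section Loss.
Context {R : realType}.
Variables (d s : nat) (lam : nat -> R) (C1 sig sigt bs : R) (th z thh : 'I_d -> R).
Hypotheses (C11 : 1 <= C1) (s0 : (0 < s)%N) (sd : (2 * s <= d)%N)
  (lam0 : forall i, (0 < i <= d)%N -> 0 < lam i)
  (hlam : forall i j, (0 < i)%N -> (i <= j <= d)%N -> lam j <= lam i)
  (lamreg : forall j k, (0 < j)%N -> (j <= k <= d)%N ->
    lam j ^+ 2 <= C1 * lam k ^+ 2 * Num.sqrt (k%:R / j%:R))
  (sig0 : 0 < sig) (sigt0 : 0 <= sigt) (sth : in_Theta s th)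
  (est : is_sorted_l1_est lam sigt (fun i => th i + sig * z i) thh)
  (hup : sigt ^+ 2 <= 8 * sig ^+ 2 * (d%:R^-1 * \sum_(i < d) z i ^+ 2))
  (hbad : (sigt < sig / 2)%R%:R <= bs).

Let tau r := lam r / (16 * C1).
Let S := d%:R^-1 * \sum_(i < d) z i ^+ 2.
Let Phi := \sum_(k < d) (k < s)%N%:R * lam k.+1 ^+ 2.
Let heads := 2 * s%:R * tau s ^+ 2 + tau s ^+ 2 * \sum_(i < d) excess (tau s) (z i).
Let tails := \sum_(k < d) (2 * s <= k)%N%:R *
  (tau (k.+1 - s) ^+ 2 * \sum_(A : {set 'I_d} | #|A| == (k.+1 - s)%N)
     \prod_(i in A) excess (tau (k.+1 - s)) (z i)).

Let sled : (s <= d)%N.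
Proof. by apply: leq_trans sd; rewrite leq_pmull. Qed.

Let C16 : 0 < 16 * C1.
Proof. by rewrite mulr_gt0 // (lt_le_trans ltr01 C11). Qed.

(** On the head, each square is at most the squared level plus an excess. On the tail, position [k]
    is dominated by k+1-s entries, so a large value there is charged to products of k+1-s
    excesses. *)
Lemma slope_terms_le :
  `| \sum_(i < d) (thh i - th i) ^+ 2 - 2 * sig * \sum_(i < d) z i * (thh i - th i) | <=
  sig ^+ 2 * (4 * heads + 2 * tails + 2 * ((sigt < sig / 2)%R%:R * (d%:R * S)) + 2 * Phi * S).
Proof.
have lam0' i : (0 < i <= d)%N -> 0 <= lam i by move=> /lam0/ltW.
have [p [pinj hcard /le_trans]] := slope_core hlam lam0' sig0 sigt0 sth est.
apply; rewrite !big_split /= !(mulrDr (sig ^+ 2)).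
have d0 : (0 < d)%N by exact: leq_trans sled.
have s2 := sqr_ge0 sig.
have sumz : d%:R * S = \sum_(k < d) z (p k) ^+ 2.
  by rewrite /S mulVKf ?pnatr_eq0 -?lt0n // [LHS](reindex_inj pinj).
have taus0 : 0 < tau s by rewrite divr_gt0 // lam0 // s0.
do 3?apply: lerD.
- rewrite (_ : sig ^+ 2 * (4 * heads) = 4 * sig ^+ 2 * heads); last by ring.
  have -> : \sum_(k < d) (k < 2 * s)%N%:R * (4 * sig ^+ 2 * z (p k) ^+ 2) =
    4 * sig ^+ 2 * \sum_(k < d) (k < 2 * s)%N%:R * z (p k) ^+ 2.
    by rewrite mulr_sumr; apply: eq_bigr => k _; rewrite mulrCA.
  apply: ler_wpM2l; first exact: mulr_ge0.
  apply: (@le_trans _ _ (\sum_(k < d) ((k < 2 * s)%N%:R * tau s ^+ 2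
      + tau s ^+ 2 * excess (tau s) (z (p k))))).
    apply: ler_sum => k _; case: (_ < _)%N; rewrite ?mul1r ?mul0r ?add0r.
      exact: sqr_le_excess.
    by rewrite mulr_ge0 ?excess_ge0 ?sqr_ge0.
  rewrite big_split /= /heads -mulr_suml -mulr_sumr.
  rewrite [\sum_(i < d) excess _ (z i)](reindex_inj pinj) /= lerD2r.
  rewrite ler_wpM2r ?sqr_ge0 // -natrM -natr_sum ler_nat.
  rewrite -big_mkcond /= sum1_card.
  by rewrite -[leqRHS](card_ord_lt sd); apply/subset_leq_card/fintype.subsetP => k; rewrite inE.
- rewrite /tails !mulr_sumr; apply: ler_sum => k _.
  case: (leqP (2 * s) k) => [sk|_]; last by rewrite !mul0r !mulr0.
  rewrite !mul1r.
  have sk' : (s <= k)%N by apply: leq_trans sk; rewrite leq_pmull.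
  have r0 : (0 < k.+1 - s)%N by rewrite subn_gt0 ltnS.
  have tr0 : 0 < tau (k.+1 - s).
    by rewrite divr_gt0 // lam0 // r0 (leq_trans (leq_subr _ _)).
  have := sqr_le_excess_prod tr0 r0 (hcard k sk').
  set rhs := _ ^+ 2 * _ => h.
  have th8 : tau (k.+1 - s) <= lam k.+1 / 8.
    have rk : (k.+1 - s <= k.+1 <= d)%N by rewrite leq_subr ltn_ord.
    exact: (regular_double C11 lam0 lamreg r0 rk (ltn_double_sub sk)).
  rewrite [leLHS]mulrCA [leRHS]mulrA [sig ^+ 2 * 2]mulrC; apply: ler_wpM2l.
    exact: mulr_ge0.
  apply: le_trans h; rewrite ler_wpM2r ?sqr_ge0 // ler_nat.
  by case: ltP => // h8; rewrite (le_lt_trans th8 h8).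
- rewrite sumz !mulr_sumr; apply: ler_sum => k _.
  by rewrite le_eqVlt; apply/orP; left; apply/eqP; ring.
- have -> : \sum_(k < d) (k < s)%N%:R * (sigt ^+ 2 * lam k.+1 ^+ 2 / 4) = sigt ^+ 2 * (Phi / 4).
    by rewrite /Phi mulr_suml mulr_sumr; apply: eq_bigr => k _; ring.
  have Phi0 : 0 <= Phi / 4.
    by rewrite divr_ge0 // sumr_ge0 // => k _; rewrite mulr_ge0 ?sqr_ge0.
  apply: le_trans (ler_wpM2r Phi0 hup) _.
  by rewrite -/S le_eqVlt; apply/orP; left; apply/eqP; field.
Qed.

(** The error is d^-1 (sig^2 (|z|^2 - d) + N), with N the difference bounded in [slope_terms_le].
    The arithmetic-geometric inequality with q = d^(-1/2) replaces the absolute deviation and the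
    product of [S] with the bad event by terms whose means are bounded separately; [bs] having mean
    O(1/d), its factor 1/q leaves O(q). *)
Lemma loss_bound (q : R) : q = (Num.sqrt d%:R)^-1 ->
  `| sigma_hat2 (fun i => th i + sig * z i) thh - sig ^+ 2 | <= sig ^+ 2 *
   (2^-1 * (q + q * (d%:R^-1 * (\sum_(i < d) z i ^+ 2 - d%:R) ^+ 2))
    + d%:R^-1 * (4 * heads + 2 * tails + 2 * Phi * S)
    + (q * S ^+ 2 + q^-1 * bs)).
Proof.
move=> qE.
have d0 : 0 < d%:R :> R by rewrite ltr0n (leq_trans _ sled).
have q0 : 0 < q by rewrite qE invr_gt0 sqrtr_gt0.
have qd : q ^+ 2 = d%:R^-1 by rewrite qE exprVn sqr_sqrtr // ltW.
have qV : q^-1 = q * d%:R by rewrite -[d%:R]invrK -qd expr2 invfM mulrA mulfV ?mul1r // gt_eqF.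
have := slope_terms_le.
set N := _ - _; set Z := \sum_(i < d) z i ^+ 2.
have e : sigma_hat2 (fun i => th i + sig * z i) thh - sig ^+ 2 =
    d%:R^-1 * (sig ^+ 2 * (Z - d%:R) + N).
  rewrite /sigma_hat2 /N mulrDr [d%:R^-1 * (sig ^+ 2 * _)]mulrCA mulrBr mulVf ?gt_eqF //.
  rewrite mulrBr mulr1 addrAC; congr (_ - _); rewrite mulrCA -mulrDr; congr (_ * _).
  rewrite /Z !mulr_sumr -sumrB -big_split /=; apply: eq_bigr => i _; ring.
rewrite e => hN {e}.
rewrite normrM (gtr0_norm (_ : 0 < d%:R^-1)) ?invr_gt0 //.
apply: (@le_trans _ _ (d%:R^-1 * (sig ^+ 2 * `|Z - d%:R|
   + sig ^+ 2 * (4 * heads + 2 * tails + 2 * ((sigt < sig / 2)%R%:R * (d%:R * S)) + 2 * Phi * S)))).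
  rewrite ler_pM2l ?invr_gt0 //; apply: le_trans (ler_normD _ _) _.
  by rewrite normrM [`|sig ^+ 2|]ger0_norm ?sqr_ge0 // lerD2l.
rewrite -mulrDr mulrCA ler_wpM2l ?sqr_ge0 //.
have h1 : d%:R^-1 * `|Z - d%:R| <= 2^-1 * (q + q * (d%:R^-1 * (Z - d%:R) ^+ 2)).
  have := amgm (d%:R^-1 * `|Z - d%:R|) q0.
  rewrite exprMn real_normK ?num_real // qV -!(mulrA q) [d%:R * _]mulrA.
  rewrite [d%:R^-1 ^+ 2]expr2 mulVKf ?gt_eqF //.
  by move: (_ * `|_|) (q * _) => x y; lra.
have h2 : 2 * ((sigt < sig / 2)%R%:R * S) <= q * S ^+ 2 + q^-1 * bs.
  have qV0 : 0 < q^-1 by rewrite invr_gt0.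
  have := hbad; case: (_ < _)%R => hbs.
    have := amgm S qV0; rewrite invrK addrC mul1r => /le_trans; apply.
    by rewrite lerD2l -[leLHS]mulr1 ler_pM2l.
  by rewrite mul0r mulr0 addr_ge0 // mulr_ge0 ?sqr_ge0 // ltW.
have -> : d%:R^-1 * (`|Z - d%:R| + (4 * heads + 2 * tails
    + 2 * ((sigt < sig / 2)%R%:R * (d%:R * S)) + 2 * Phi * S)) =
  d%:R^-1 * `|Z - d%:R| + d%:R^-1 * (4 * heads + 2 * tails + 2 * Phi * S)
   + 2 * ((sigt < sig / 2)%R%:R * S).
  have -> : (sigt < sig / 2)%R%:R * S = d%:R^-1 * ((sigt < sig / 2)%R%:R * (d%:R * S)).
    by rewrite mulrCA mulVKf // gt_eqF.
  by move: (_%:R * (d%:R * S)) (d%:R^-1) => x y; ring.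
by rewrite !lerD.
Qed.

End Loss.

(** * From the pointwise bound to the risk *)

Lemma sum_half_shift_le {R : realType} d s n (a : R) : (s <= n)%N -> 0 <= a ->
  \sum_(k < d) (n <= k)%N%:R * (a * 2^-1 ^+ (k.+1 - s)) <= a.
Proof.
move=> sn a0.
(* Closed form of the geometric sum; truncated subtraction keeps it valid for d < s, where the sum
   is 0 and the remainder 2^0 = 1. *)
have e : \sum_(k < d) (s <= k)%N%:R * 2^-1 ^+ (k.+1 - s) + 2^-1 ^+ (d - s) = 1 :> R.
  elim: d => [|d IH]; first by rewrite big_ord0 sub0n expr0 add0r.
  rewrite big_ord_recr /= -[RHS]IH -addrA; congr (_ + _).
  case: (leqP s d) => sd; first by rewrite subSn // exprS mul1r; field.
  have -> : (d.+1 - s = 0)%N by apply/eqP; rewrite subn_eq0.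
  have -> : (d - s = 0)%N by apply/eqP; rewrite subn_eq0 ltnW.
  by rewrite mul0r add0r.
apply: (@le_trans _ _ (a * \sum_(k < d) (s <= k)%N%:R * 2^-1 ^+ (k.+1 - s))).
  rewrite mulr_sumr; apply: ler_sum => k _; rewrite mulrCA ler_wpM2l //.
  rewrite ler_wpM2r ?exprn_ge0 ?invr_ge0 // ler_nat.
  by case: (leqP n k) => // nk; rewrite (leq_trans sn nk).
by rewrite -[leRHS]mulr1 ler_wpM2l // -[leRHS]e lerDl exprn_ge0 // invr_ge0.
Qed.

Section Risk.
Context {R : realType} {d0 : measure_display} {Omega : measurableType d0}.
Variables (P : probability Omega R) (mu : probability R R) (kap C1 sigma : R).
Variables (d m s : nat) (lam : nat -> R) (B : 'I_m -> {set 'I_d})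
  (thetahat : ('I_d -> R) -> ('I_d -> R)) (xi : 'I_d -> Omega -> R) (theta : 'I_d -> R).
Hypotheses (k1 : 1 <= kap) (C11 : 1 <= C1) (s0 : (0 < s)%N) (sm : (4 * s < m)%N)
  (md : (m <= d)%N) (mk : m%:R <= d%:R / (128 * kap)) (partB : is_block_partition B)
  (est : forall y, is_sorted_l1_est lam (mom_sigma B y) y (thetahat y))
  (iid : iid_with P xi mu)
  (h2 : (\int[mu]_x (x ^+ 2)%:E = 1)%E) (h4 : Ebound mu (fun x => x ^+ 4) kap)
  (lam0 : forall i, (0 < i <= d)%N -> 0 < lam i)
  (hlam : forall i j, (0 < i)%N -> (i <= j <= d)%N -> lam j <= lam i)
  (lamreg : forall j k, (0 < j)%N -> (j <= k <= d)%N ->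
    lam j ^+ 2 <= C1 * lam k ^+ 2 * Num.sqrt (k%:R / j%:R))
  (htail : forall r, (0 < r <= d)%N -> exists g,
    [/\ 0 <= g, expR 1 * d%:R * g <= r%:R / 2 & Ebound mu (excess (lam r / (16 * C1))) g])
  (sigma0 : 0 < sigma) (sth : in_Theta s theta).

Let sd : (2 * s <= d)%N.
Proof. by apply: leq_trans md; apply: ltnW; apply: leq_ltn_trans sm; rewrite leq_mul2r orbT. Qed.

Let sled : (s <= d)%N.
Proof. by apply: leq_trans sd; rewrite leq_pmull. Qed.

Let d_gt0 : 0 < d%:R :> R.
Proof. by rewrite ltr0n (leq_trans s0). Qed.

Let tau r := lam r / (16 * C1).

Let tau2 r : (0 < r <= d)%N -> tau r ^+ 2 <= lam r ^+ 2.
Proof.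
move=> rd; have lr := lam0 rd.
have C16 : 1 <= 16 * C1 by have := C11; lra.
rewrite lerXn2r ?nnegrE ?(ltW lr) ?divr_ge0 ?(ltW lr) ?(le_trans ler01) //.
by rewrite ler_pdivrMr ?(lt_le_trans ltr01) // ler_peMr // ltW.
Qed.

Let sqr_mean : Ebound P (fun w => d%:R^-1 * \sum_(i < d) xi i w ^+ 2) 1.
Proof.
have E2 : Ebound mu (fun x => x ^+ 2) 1.
  by split; [exact: exprn_measurable|move=> w; exact: sqr_ge0|rewrite h2].
have := @Ebound_sum _ _ _ P _ (index_enum 'I_d) xpredT (fun i w => xi i w ^+ 2) (fun=> 1).
move=> /(_ (fun i _ => iid_Ebound i iid E2)) h.
have := Ebound_scale (_ : 0 <= d%:R^-1) h; rewrite invr_ge0 ler0n => /(_ isT).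
by rewrite sumr_const card_ord mulVf ?gt_eqF.
Qed.

Let sqr_mean_sqr : Ebound P (fun w => (d%:R^-1 * \sum_(i < d) xi i w ^+ 2) ^+ 2) kap.
Proof.
have := Ebound_scale (sqr_ge0 d%:R^-1) (Ebound_iid_sum_sqr iid h2 h4).
under eq_fun do rewrite -exprMn.
apply: Ebound_le; rewrite exprVn mulrC ler_pdivrMr ?exprn_gt0 //.
rewrite -subr_ge0 (_ : _ - _ = (kap - 1) * d%:R * (d%:R - 1)); last by ring.
by rewrite !mulr_ge0 ?subr_ge0 // ler1n (leq_trans s0).
Qed.

Let excess_sum : Ebound P (fun w => \sum_(i < d) excess (tau s) (xi i w)) s%:R.
Proof.
have [|g [g0 hg Eg]] := @htail s; first by rewrite s0.
have := @Ebound_sum _ _ _ P _ (index_enum 'I_d) xpredT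
  (fun i w => excess (tau s) (xi i w)) (fun=> g).
move=> /(_ (fun i _ => iid_Ebound i iid Eg)); apply: Ebound_le.
rewrite sumr_const card_ord -[leLHS]mulr_natl.
apply: (@le_trans _ _ (expR 1 * d%:R * g)).
  rewrite -mulrA ler_peMl ?mulr_ge0 ?ler0n //.
  by apply: le_trans (expR_ge1Dx _); rewrite lerDl.
by apply: (le_trans hg); rewrite ler_pdivrMr // ler_peMr ?ler0n // ler1n.
Qed.

(** By [htail] the term at [k] has mean at most tau_r^2 2^-r with r = k+1-s. Since k >= 2s gives r
    >= s, tau_r <= lam_r <= lam_s, and the geometric series sums to at most 1. *)
Let tails_sum : Ebound P (fun w => \sum_(k < d) (2 * s <= k)%N%:R *
  (tau (k.+1 - s) ^+ 2 * \sum_(A : {set 'I_d} | #|A| == (k.+1 - s)%N)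
     \prod_(i in A) excess (tau (k.+1 - s)) (xi i w))) (lam s ^+ 2).
Proof.
have ss : (s <= 2 * s)%N by rewrite leq_pmull.
apply: (@Ebound_le _ _ _ _ _ (\sum_(k < d) (2 * s <= k)%N%:R * (lam s ^+ 2 * 2^-1 ^+ (k.+1 - s)))).
  by apply: sum_half_shift_le => //; exact: sqr_ge0.
apply: Ebound_sum => k _; case: (leqP (2 * s) k) => [sk|_]; last first.
  under eq_fun do rewrite mul0r.
  by rewrite mul0r; exact: (Ebound_cst _ (lexx 0)).
under eq_fun do rewrite mul1r.
rewrite mul1r.
have r0 : (0 < k.+1 - s)%N by rewrite subn_gt0 ltnS (leq_trans ss).
have rd : (0 < k.+1 - s <= d)%N by rewrite r0 (leq_trans (leq_subr _ _)).
have [g [g0 hg Eg]] := htail rd.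
have := Ebound_scale (sqr_ge0 (tau (k.+1 - s))) (Ebound_excess_sum iid r0 g0 Eg hg).
apply: Ebound_le; rewrite ler_wpM2r ?exprn_ge0 ?invr_ge0 //.
apply: le_trans (tau2 rd) _.
have sr : (s <= k.+1 - s)%N.
  by rewrite leq_subRL ?(leq_trans ss (leq_trans sk _)) // addnn -mul2n (leq_trans sk).
rewrite lerXn2r ?nnegrE ?(ltW (lam0 _)) ?s0 //.
by apply: hlam => //; rewrite sr; case/andP: rd.
Qed.

Lemma risk_bound :
  (\int[P]_w (`| sigma_hat2 (obs theta sigma xi w) (thetahat (obs theta sigma xi w))
                   - sigma ^+ 2 |)%:E
   <= ((130 * kap + 18 * C1) * sigma ^+ 2 * Num.max (Num.sqrt d%:R)^-1
        (s%:R * lam s ^+ 2 / d%:R))%:E)%E.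
Proof.
have [blk hblk sz] := block_partitionP partB.
have k0 : 0 < kap by exact: lt_le_trans k1.
pose q : R := (Num.sqrt d%:R)^-1.
have q0 : 0 < q by rewrite invr_gt0 sqrtr_gt0.
have q2 : q ^+ 2 = d%:R^-1 by rewrite exprVn sqr_sqrtr // ltW.
pose a : R := (2 * kap)^-1.
have a0 : 0 <= a by rewrite invr_ge0 mulr_ge0 // ltW.
have := @loss_bound R d s lam C1 sigma.
set L := s%:R * lam s ^+ 2.
set Phi := \sum_(k < d) (k < s)%N%:R * lam k.+1 ^+ 2.
have Phi0 : 0 <= Phi.
  by apply: sumr_ge0 => k _; rewrite mulr_ge0 ?sqr_ge0.
have PhiL : Phi <= 2 * C1 * L by exact: sum_sqr_regular_le.
(* [Q] is the measurable majorant of the loss divided by sigma^2, free of [thetahat] and arranged so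
   that [Ebound] can be applied term by term. *)
pose Q w := 2^-1 * (cst q w + q * (d%:R^-1 * (\sum_(i < d) xi i w ^+ 2 - d%:R) ^+ 2))
  + d%:R^-1 * (4 * (cst (2 * s%:R * tau s ^+ 2) w + tau s ^+ 2 * \sum_(i < d) excess (tau s) (xi i w))
     + 2 * \sum_(k < d) (2 * s <= k)%N%:R *
      (tau (k.+1 - s) ^+ 2 * \sum_(A : {set 'I_d} | #|A| == (k.+1 - s)%N)
       \prod_(i in A) excess (tau (k.+1 - s)) (xi i w))
     + 2 * Phi * (d%:R^-1 * \sum_(i < d) xi i w ^+ 2))
  + (q * (d%:R^-1 * \sum_(i < d) xi i w ^+ 2) ^+ 2
     + q^-1 * \sum_(W : {set 'I_m} | (m < 4 * #|W|)%N)
       \prod_(j in [set j | blk j \in W]%SET) expR (a * (4^-1 - xi j w ^+ 2))).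
move=> loss.
have EQ : Ebound P Q (2^-1 * (q + q * (d%:R^-1 * (d%:R * kap)))
  + d%:R^-1 * (4 * (2 * s%:R * tau s ^+ 2 + tau s ^+ 2 * s%:R) + 2 * lam s ^+ 2 + 2 * Phi * 1)
  + (q * kap + q^-1 * (128 * kap / d%:R))).
  have dV0 : 0 <= d%:R^-1 :> R by rewrite invr_ge0.
  apply: Ebound_add; first apply: Ebound_add.
  - apply: Ebound_scale => //.
    apply: Ebound_add; first exact/Ebound_cst/ltW.
    apply: Ebound_scale; first exact: ltW.
    apply: Ebound_scale => //; exact: (Ebound_iid_dev iid h2 h4).
  - apply: Ebound_scale => //; apply: Ebound_add; first apply: Ebound_add.
    + apply: Ebound_scale => //; apply: Ebound_add.
        by apply: Ebound_cst; rewrite mulr_ge0 ?sqr_ge0 // mulr_ge0.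
      by apply: Ebound_scale; [exact: sqr_ge0|exact: excess_sum].
    + by apply: Ebound_scale => //; exact: tails_sum.
    + by apply: Ebound_scale; [exact: mulr_ge0|exact: sqr_mean].
  - apply: Ebound_add.
      by apply: Ebound_scale; [exact: ltW|exact: sqr_mean_sqr].
    apply: Ebound_scale; first by rewrite invr_ge0 ltW.
    exact: (Ebound_bad_blocks iid partB (leq_ltn_trans (leq0n _) sm) md hblk k1 mk h2 h4).
have [mQ Q0 hQ] := Ebound_scale (sqr_ge0 sigma) EQ.
apply: le_trans (le_trans hQ _); last first.
  rewrite lee_fin [leRHS]mulrAC [leRHS]mulrC; apply: ler_wpM2l; first exact: sqr_ge0.
  (* 130 kap collects (1 + kap)/2 <= kap from the deviation, kap from the squared mean and 128 kap
     from the bad blocks; 18 C1 collects 12 from the head, 2 from the tail and 4 C1 from Phi <= 2 C1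
     L. *)
  set M := Num.max _ _.
  have qM : q <= M by rewrite le_max lexx.
  have LM : L / d%:R <= M by rewrite le_max lexx orbT.
  have L0 : 0 <= L by rewrite mulr_ge0 ?sqr_ge0.
  have qV : q^-1 * (128 * kap / d%:R) = 128 * kap * q.
    by rewrite -q2 expr2; field; rewrite gt_eqF.
  have h1 : d%:R^-1 * (4 * (2 * s%:R * tau s ^+ 2 + tau s ^+ 2 * s%:R) + 2 * lam s ^+ 2 + 2 * Phi * 1)
     <= 18 * C1 * (L / d%:R).
    rewrite mulrA [leRHS]mulrC ler_wpM2l ?invr_ge0 //.
    have t1 : tau s ^+ 2 * s%:R <= L.
      by rewrite /L mulrC ler_wpM2l // tau2 // s0.
    have t2 : lam s ^+ 2 <= L by rewrite /L ler_peMl ?sqr_ge0 // ler1n.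
    have t3 : L <= C1 * L by rewrite ler_peMl.
    lra.
  rewrite qV mulKf ?gt_eqF //.
  apply: (@le_trans _ _ (130 * kap * q + 18 * C1 * (L / d%:R))).
    have : q <= kap * q by rewrite ler_peMl // ltW.
    move: h1; set X := d%:R^-1 * _; set Y := 18 * _ * _; move: X Y => X Y h1.
    have -> : q * (kap) = kap * q by rewrite mulrC.
    rewrite -!(mulrA _ kap); move: (kap * q) => u; lra.
  rewrite [leRHS]mulrDl; apply: lerD; rewrite ler_wpM2l // mulr_ge0 // ?(ltW k0) //.
  exact: le_trans ler01 C11.
apply: ge0_integral_le_nomeas => w; first by rewrite lee_fin.
rewrite lee_fin.
have hup := mom_sigma_upper (fun i => xi i w) partB md sm sth sigma0.
have hbad := mom_sigma_lower (fun i => xi i w) partB md sm sth sigma0 hblk a0.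
exact: (loss _ _ theta (fun i => xi i w) (thetahat (obs theta sigma xi w)) C11 s0 sd lam0 hlam
  lamreg sigma0 (sqrtr_ge0 _) sth (est _) hup hbad q erefl).
Qed.

End Risk.

(** * Excesses and fourth moments under a polynomial tail *)

Lemma Ebound_mono {R : realType} {d0 : measure_display} {T : measurableType d0}
    (P : probability T R) (f g : T -> R) (c : R) :
  measurable_fun setT f -> (forall w, 0 <= f w <= g w) -> Ebound P g c -> Ebound P f c.
Proof.
move=> mf fg [mg g0 hg]; split=> // [w|]; first by case/andP: (fg w).
by apply: le_trans hg; apply: ge0_integral_le_nomeas => w; rewrite lee_fin; case/andP: (fg w).
Qed.

(** For b >= 4 the dyadic ratio is at most 4/16, so the geometric factor 4/(1 - r) is at most 16/3
    <= 6. *)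
Lemma Ebound_excess_tail {R : realType} (mu : probability R R) (t D b : R) :
  0 < t -> 0 <= D -> 4 <= b ->
  (forall x, t <= x -> (mu [set y : R | (x < `|y|)%R] <= (D * x `^ (- b))%:E)%E) ->
  Ebound mu (excess t) (6 * (D * t `^ (- b))).
Proof.
move=> t0 D0 b4 htail.
have h16 : 2 `^ (- b) <= 16^-1 :> R.
  apply: (@le_trans _ _ (2 `^ (- 4))); first by rewrite ler_powR ?ler1n // lerN2.
  by rewrite powRN powR_mulrn // -natrX.
have rlt : 2 ^+ 2 * 2 `^ (- b) <= 4^-1 :> R by rewrite -natrX; lra.
have := tail_moment t0 D0 (le_lt_trans rlt _) htail.
rewrite invf_lt1 ?ltr1n // => /(_ isT) h.
have := Ebound_scale (sqr_ge0 t^-1) h.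
have -> : (fun x : R => t^-1 ^+ 2 * (`|x| ^+ 2 * (t < `|x|)%R%:R)) = excess t.
  apply/funext => x; rewrite /excess mulrA; congr (_ * _).
  by rewrite !exprMn real_normK ?num_real // mulrC.
apply: Ebound_le; set r := 2 ^+ 2 * _ in rlt h *.
have T0 : 0 <= D * t `^ (- b) by rewrite mulr_ge0 ?powR_ge0.
have e : t^-1 ^+ 2 * (2 ^+ 2 * t ^+ 2 * (D * t `^ (- b)) / (1 - r)) =
   4 * (D * t `^ (- b)) / (1 - r).
  have -> : 2 ^+ 2 = 4 :> R by rewrite -natrX.
  by field; rewrite subr_eq0 gt_eqF ?gt_eqF //; lra.
rewrite e ler_pdivrMr; last by rewrite subr_gt0; lra.
nra.
Qed.

(** The part |x| <= 2 contributes at most 2^4; the rest is the dyadic tail bound of order 4 at level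
    2, where the tail assumption starts. *)
Definition fourth_bound {R : realType} (D b : R) : R :=
  16 + 2 ^+ 4 * 2 ^+ 4 * (D * 2 `^ (- b)) / (1 - 2 ^+ 4 * 2 `^ (- b)).

Lemma fourth_ratio_lt1 {R : realType} (b : R) : 4 < b -> 2 ^+ 4 * 2 `^ (- b) < 1.
Proof.
move=> b4; rewrite powRN ltr_pdivrMr ?powR_gt0 // mul1r.
by rewrite -powR_mulrn // /powR pnatr_eq0 /= ltr_expR ltr_pM2r // ln_gt0 // ltr1n.
Qed.

Lemma fourth_bound_ge1 {R : realType} (D b : R) : 0 <= D -> 4 < b -> 1 <= fourth_bound D b.
Proof.
move=> D0 b4; apply: (@le_trans _ _ 16); first by rewrite ler1n.
rewrite lerDl divr_ge0 ?mulr_ge0 ?powR_ge0 // subr_ge0 ltW //.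
exact: fourth_ratio_lt1.
Qed.

Lemma Ebound_fourth_tail {R : realType} (mu : probability R R) (D b : R) :
  0 <= D -> 4 < b ->
  (forall x, 2 <= x -> (mu [set y : R | (x < `|y|)%R] <= (D * x `^ (- b))%:E)%E) ->
  Ebound mu (fun x => x ^+ 4) (fourth_bound D b).
Proof.
move=> D0 b4 htail.
have h := tail_moment (ltr0n _ 2) D0 (fourth_ratio_lt1 b4) htail.
have := Ebound_add (@Ebound_cst _ _ _ mu 16 _) h; rewrite ler0n => /(_ isT).
apply: Ebound_mono; first exact: exprn_measurable.
move=> x; rewrite exprn_even_ge0 //= /cst.
have -> : x ^+ 4 = `|x| ^+ 4.
  by rewrite (exprM x 2 2) (exprM `|x| 2 2) real_normK ?num_real.
case: ltP => [_|x2]; rewrite ?mulr1 ?mulr0; first by rewrite lerDr.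
by rewrite addr0 (le_trans (lerXn2r 4 _ _ x2)) ?nnegrE // -natrX ler_nat.
Qed.

Lemma powR_inv_neg {R : realType} (x r : R) : 0 <= x -> (x^-1) `^ r = x `^ (- r).
Proof. by move=> x0; rewrite -powR_inv1 // -powRrM mulN1r. Qed.

Lemma nblocks_le {R : realType} (g : R) d : 0 <= g -> (nblocks g d)%:R <= g * d%:R.
Proof. by move=> g0; rewrite truncn_le mulr_ge0. Qed.

Lemma max_scale_le {R : realType} (K c q x : R) : 0 <= K -> 1 <= c -> 0 <= q ->
  K * Num.max q (c ^+ 2 * x) <= K * c ^+ 2 * Num.max q x.
Proof.
move=> K0 c1 q0; rewrite -mulrA ler_wpM2l //.
have c2 : 1 <= c ^+ 2 by rewrite exprn_ege1.
have M0 : 0 <= Num.max q x by rewrite le_max q0.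
rewrite ge_max; apply/andP; split.
  apply: (@le_trans _ _ (Num.max q x)); first by rewrite le_max lexx.
  by rewrite ler_peMl.
by rewrite ler_wpM2l ?le_max ?lexx ?orbT // sqr_ge0.
Qed.

Section RiskBlocks.
Context {R : realType} {d0 : measure_display} {Omega : measurableType d0}.
Variables (P : probability Omega R) (mu : probability R R) (kap C1 c sigma x : R).
Variables (d s : nat) (lam : nat -> R) (gam : R) (B : 'I_(nblocks gam d) -> {set 'I_d})
  (thetahat : ('I_d -> R) -> ('I_d -> R)) (xi : 'I_d -> Omega -> R) (theta : 'I_d -> R).
Hypotheses (k1 : 1 <= kap) (C11 : 1 <= C1) (c1 : 1 <= c) (gamE : gam = (128 * kap)^-1)
  (s0 : (0 < s)%N) (sm : (4 * s < nblocks gam d)%N) (partB : is_block_partition B)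
  (est : forall y, is_sorted_l1_est lam (mom_sigma B y) y (thetahat y))
  (iid : iid_with P xi mu)
  (h2 : (\int[mu]_x (x ^+ 2)%:E = 1)%E) (h4 : Ebound mu (fun x => x ^+ 4) kap)
  (lam0 : forall i, (0 < i <= d)%N -> 0 < lam i)
  (hlam : forall i j, (0 < i)%N -> (i <= j <= d)%N -> lam j <= lam i)
  (lamreg : forall j k, (0 < j)%N -> (j <= k <= d)%N ->
    lam j ^+ 2 <= C1 * lam k ^+ 2 * Num.sqrt (k%:R / j%:R))
  (htail : forall r, (0 < r <= d)%N -> exists g,
    [/\ 0 <= g, expR 1 * d%:R * g <= r%:R / 2 & Ebound mu (excess (lam r / (16 * C1))) g])
  (sigma0 : 0 < sigma) (sth : in_Theta s theta)
  (rate : (s <= d)%N -> s%:R * lam s ^+ 2 / d%:R = c ^+ 2 * x).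

(** The choice of [gam] is exactly what gives m <= d/(128 kap), the budget for the union bound over
    sets of blocks; [x] is the announced rate. *)
Lemma risk_bound_nblocks :
  (\int[P]_w (`| sigma_hat2 (obs theta sigma xi w) (thetahat (obs theta sigma xi w))
                   - sigma ^+ 2 |)%:E
   <= ((130 * kap + 18 * C1) * c ^+ 2 * sigma ^+ 2 * Num.max (Num.sqrt d%:R)^-1 x)%:E)%E.
Proof.
have k0 : 0 < kap by exact: lt_le_trans k1.
have mk : (nblocks gam d)%:R <= d%:R / (128 * kap).
  by rewrite mulrC -gamE; apply: nblocks_le; rewrite gamE invr_ge0 mulr_ge0 // ltW.
have md : (nblocks gam d <= d)%N.
  rewrite -(ler_nat R); apply: (le_trans mk).
  rewrite ler_pdivrMr ?mulr_gt0 // ler_peMr ?ler0n //.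
  by have := k1; lra.
have sd : (s <= d)%N.
  by apply: leq_trans md; apply: ltnW; apply: leq_ltn_trans sm; rewrite leq_pmull.
apply: (le_trans (risk_bound k1 C11 s0 sm md mk partB est iid h2 h4 lam0 hlam lamreg htail
  sigma0 sth)).
rewrite (rate sd) lee_fin.
have K0 : 0 <= (130 * kap + 18 * C1) * sigma ^+ 2.
  by rewrite mulr_ge0 ?sqr_ge0 //; have := k1; have := C11; lra.
apply: le_trans (max_scale_le x K0 c1 _) _; first by rewrite invr_ge0 sqrtr_ge0.
by rewrite le_eqVlt; apply/orP; left; apply/eqP; rewrite (mulrAC _ (sigma ^+ 2)).
Qed.

End RiskBlocks.

(** * Polynomial tails: the second claim *)

Lemma ratio_ge1 {R : realType} (d j : nat) : (0 < j <= d)%N -> 1 <= d%:R / j%:R :> R.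
Proof. by case/andP => j0 jd; rewrite ler_pdivlMr ?ltr0n // mul1r ler_nat. Qed.

(** The squared ratio of weights is (k/j)^(2/a), and 2/a < 1/2 because a > 4; the constant is 1. *)
Lemma poly_weights_regular {R : realType} (c a : R) (d j k : nat) :
  4 < a -> (0 < j)%N -> (j <= k <= d)%N ->
  (c * (d%:R / j%:R) `^ a^-1) ^+ 2 <=
  1 * (c * (d%:R / k%:R) `^ a^-1) ^+ 2 * Num.sqrt (k%:R / j%:R).
Proof.
move=> a4 j0 /andP[jk kd]; have a0 : 0 < a by apply: lt_trans a4.
have k0 : (0 < k)%N by apply: leq_trans jk.
have kj1 : 1 <= k%:R / j%:R :> R by apply: ratio_ge1; rewrite j0.
have -> : d%:R / j%:R = (d%:R / k%:R) * (k%:R / j%:R) :> R.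
  by rewrite mulrA divfK // pnatr_eq0 -lt0n.
rewrite powRM ?divr_ge0 // mulrA [leLHS]exprMn mul1r ler_wpM2l ?sqr_ge0 //.
rewrite -powR12_sqrt ?divr_ge0 // -powR_mulrn ?powR_ge0 // -powRrM ler_powR //.
by rewrite mulrC ler_pdivrMr //; lra.
Qed.

Lemma class_P_tail {R : realType} (a tau : R) (mu : probability R R) x :
  0 < tau -> class_P a tau mu -> 2 <= x ->
  (mu [set y : R | (x < `|y|)%R] <= (tau `^ a * x `^ (- a))%:E)%E.
Proof.
move=> tau0 [_ [_ [_ htail]]] x2; apply: (le_trans (htail x x2)).
have x0 : 0 <= x by apply: le_trans x2.
by rewrite powRM ?(ltW tau0) ?invr_ge0 // powR_inv_neg.
Qed.

(** With y = d/r, the tail at the level is (16 tau/c)^a / y. The summand 192 e tau of [c] gives 16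
    tau/c <= 1/(12 e), a bound kept by the power a >= 1, and 6 e/(12 e) = 1/2. The summand 32 puts
    the level above 2. *)
Lemma poly_excess {R : realType} (a tau c : R) (mu : probability R R) (d r : nat) :
  4 < a -> 0 < tau -> c = 32 + 192 * expR 1 * tau -> class_P a tau mu -> (0 < r <= d)%N ->
  exists g, [/\ 0 <= g, expR 1 * d%:R * g <= r%:R / 2 &
    Ebound mu (excess (c * (d%:R / r%:R) `^ a^-1 / (16 * 1))) g].
Proof.
move=> a4 tau0 cE hmu rd; have a0 : 0 < a by apply: lt_trans a4.
have e0 : 1 <= expR 1 :> R by apply: le_trans (expR_ge1Dx _); rewrite lerDl.
have et : 0 < expR 1 * tau by rewrite mulr_gt0 // expR_gt0.
have c32 : 32 <= c by rewrite cE lerDl -mulrA mulr_ge0 // ltW.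
have c0 : 0 < c by apply: lt_le_trans c32.
have y1 := @ratio_ge1 R d r rd; set y := d%:R / r%:R in y1 *.
have r0 : 0 < r%:R :> R by rewrite ltr0n; case/andP: rd.
have ya1 : 1 <= y `^ a^-1 by rewrite -(powRr0 y) ler_powR // invr_ge0 ltW.
set t := c * _ / _.
have t2 : 2 <= t.
  rewrite /t ler_pdivlMr ?mulr_gt0 //.
  apply: (@le_trans _ _ c); first by lra.
  by rewrite ler_peMr // ltW.
have t0 : 0 < t by apply: lt_le_trans t2.
exists (6 * (tau `^ a * t `^ (- a))); split; last first.
- apply: Ebound_excess_tail => //; [exact: powR_ge0|exact: ltW|].
  by move=> x tx; apply: class_P_tail => //; exact: le_trans tx.
- rewrite -powR_inv_neg ?(ltW t0) // -powRM ?invr_ge0 ?(ltW tau0) ?(ltW t0) //.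
  have yE : (y^-1) `^ a^-1 `^ a = y^-1.
    by rewrite -powRrM mulVf ?gt_eqF // powRr1 // invr_ge0 (le_trans ler01).
  have y0 : 0 <= y by apply: le_trans y1.
  have -> : tau / t = (16 * tau / c) * (y^-1 `^ a^-1).
    rewrite powR_inv_neg // powRN /t; field.
    by rewrite !gt_eqF // powR_gt0 // (lt_le_trans ltr01).
  rewrite powRM ?powR_ge0 ?divr_ge0 ?mulr_ge0 ?(ltW tau0) ?(ltW c0) // yE.
  have hz : 16 * tau / c <= (12 * expR 1)^-1.
    by rewrite ler_pdivrMr // [leRHS]mulrC ler_pdivlMr ?mulr_gt0 ?expR_gt0 // cE; lra.
  have hp : (16 * tau / c) `^ a <= (12 * expR 1)^-1.
    apply: le_trans (hz); apply: ge1r_powR; last by lra.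
    rewrite divr_gt0 ?mulr_gt0 //=; apply: (le_trans hz).
    by rewrite invf_le1 ?mulr_gt0 ?expR_gt0 //; lra.
  have -> : expR 1 * d%:R * (6 * ((16 * tau / c) `^ a * y^-1)) =
     r%:R * (6 * expR 1 * (16 * tau / c) `^ a).
    rewrite /y; field; rewrite !gt_eqF //; case/andP: rd => r1 r2.
    by rewrite ltr0n (leq_trans r1).
  rewrite ler_wpM2l ?(ltW r0) //.
  apply: (@le_trans _ _ (6 * expR 1 * (12 * expR 1)^-1)).
    by rewrite ler_wpM2l // mulr_ge0 // (le_trans ler01).
  by rewrite le_eqVlt; apply/orP; left; apply/eqP; field; rewrite gt_eqF // expR_gt0.
- by rewrite !mulr_ge0 ?powR_ge0.
Qed.

Lemma poly_rate {R : realType} (c a : R) (d s : nat) : (0 < s)%N -> (s <= d)%N ->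
  s%:R * (c * (d%:R / s%:R) `^ a^-1) ^+ 2 / d%:R = c ^+ 2 * (s%:R / d%:R) `^ (1 - 2 / a).
Proof.
move=> s0 sd; have d0 : (0 < d)%N by apply: leq_trans sd.
have x0 : 0 < s%:R / d%:R :> R by rewrite divr_gt0 ?ltr0n.
rewrite powRB ?(gt_eqF x0) ?implybT // powRr1 ?(ltW x0) //.
rewrite -powRN -powR_inv_neg ?(ltW x0) // invf_div.
have -> : (c * (d%:R / s%:R) `^ a^-1) ^+ 2 = c ^+ 2 * (d%:R / s%:R) `^ (2 / a).
  by rewrite exprMn -(powR_mulrn 2 (powR_ge0 _ _)) -powRrM [a^-1 * _]mulrC.
by ring.
Qed.

Lemma risk_bound_class_P (R : realType) (a tau : R) : 4 < a -> 0 < tau ->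
   exists c C gam : R, 0 < c /\ 0 < C /\ 0 < gam /\ gam <= 2^-1 /\
   forall s d : nat, (1 <= s)%N -> (4 * s < nblocks gam d)%N ->
   let lam := fun j : nat => c * (d%:R / j%:R) `^ a^-1 in
   forall B : 'I_(nblocks gam d) -> {set 'I_d}, is_block_partition B ->
   forall thetahat : ('I_d -> R) -> ('I_d -> R),
     (forall y, is_sorted_l1_est lam (mom_sigma B y) y (thetahat y)) ->
   forall (d0 : measure_display) (Omega : measurableType d0)
          (P : probability Omega R) (mu : probability R R) (xi : 'I_d -> Omega -> R),
     class_P a tau mu -> iid_with P xi mu ->
   forall sigma : R, 0 < sigma ->
   forall theta : 'I_d -> R, in_Theta s theta ->
     (\int[P]_w (`| sigma_hat2 (obs theta sigma xi w) (thetahat (obs theta sigma xi w))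
                   - sigma ^+ 2 |)%:E
      <= (C * sigma ^+ 2 * Num.max (Num.sqrt d%:R)^-1
             ((s%:R / d%:R) `^ (1 - 2 / a)))%:E)%E.
Proof.
move=> a4 tau0; have a0 : 0 < a by apply: lt_trans a4.
pose kap := fourth_bound (tau `^ a) a.
have k1 : 1 <= kap by apply: fourth_bound_ge1 => //; exact: powR_ge0.
pose c := 32 + 192 * expR 1 * tau.
have c32 : 32 <= c by rewrite lerDl !mulr_ge0 ?expR_ge0 // ltW.
have c1 : 1 <= c by apply: le_trans c32; rewrite ler1n.
have c0 : 0 < c by apply: lt_le_trans c1.
have k0 : 0 < kap by apply: lt_le_trans k1.
exists c, ((130 * kap + 18 * 1) * c ^+ 2), ((128 * kap)^-1); do 4?split => //.
- by rewrite mulr_gt0 ?exprn_gt0 //; lra.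
- by rewrite invr_gt0 mulr_gt0.
- by rewrite lef_pV2 ?posrE ?mulr_gt0 //; lra.
move=> s d s0 sm lam B partB thetahat est d0 Omega P mu xi hmu iid sigma sigma0 theta sth.
have [_ [_ [h2 _]]] := hmu.
apply: (@risk_bound_nblocks _ _ _ P mu kap 1 c sigma _ d s lam _ B thetahat xi theta) => //.
- apply: Ebound_fourth_tail => //; first exact: powR_ge0.
  by move=> x x2; apply: class_P_tail.
- move=> i /ratio_ge1 y1; rewrite mulr_gt0 // powR_gt0 //.
  exact: lt_le_trans (y1 R).
- move=> i j i0 /andP[ij jd]; rewrite ler_wpM2l ?(ltW c0) //.
  rewrite ge0_ler_powR ?nnegrE ?divr_ge0 ?invr_ge0 ?(ltW a0) //.
  by rewrite ler_wpM2l // lef_pV2 ?posrE ?ltr0n ?ler_nat // (leq_trans i0).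
- by move=> j k; exact: poly_weights_regular.
- by move=> r; exact: (poly_excess a4 tau0 erefl hmu).
- by move=> sd; exact: poly_rate.
Qed.

(** * Exponential tails: the first claim *)

(** Raise u <= e^u, with u = y/(2p), to the power [p]. *)
Lemma expRN_half_le_powR {R : realType} (p y : R) : 0 < p -> 0 < y ->
  expR (- (y / 2)) <= (2 * p) `^ p * y `^ (- p).
Proof.
move=> p0 y0; have pp : 0 < 2 * p by rewrite mulr_gt0.
have h : (y / (2 * p)) `^ p <= expR (y / 2).
  apply: (@le_trans _ _ (expR (y / (2 * p)) `^ p)).
    rewrite ge0_ler_powR ?nnegrE ?expR_ge0 ?divr_ge0 ?(ltW p0) ?(ltW y0) ?(ltW pp) //.
    by apply: le_trans (expR_ge1Dx _); rewrite lerDr.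
  rewrite /powR gt_eqF ?expR_gt0 // expRK ler_expR le_eqVlt; apply/orP; left; apply/eqP.
  by field; rewrite gt_eqF.
rewrite expRN powRN -[X in _ <= X]invf_div lef_pV2 ?posrE ?expR_gt0 ?divr_gt0 ?powR_gt0 //.
apply: le_trans h; rewrite [leRHS]powRM ?invr_ge0 ?(ltW y0) ?(ltW pp) //.
by rewrite powR_inv_neg ?(ltW pp) // powRN.
Qed.

(** The constant for which exp(-(x/tau)^a / 2) is at most this times x^-6: the previous lemma with p
    = 6/a. The exponent 6 exceeds 4, as [fourth_bound] requires. *)
Definition exp_const {R : realType} (a tau : R) : R := (2 * (6 / a)) `^ (6 / a) * tau `^ 6.

(** The exponential is split into two halves: one, frozen at level [t], keeps the smallness in [t];
    the other becomes x^-6, so that the polynomial lemmas apply. *)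
Lemma class_G_tail {R : realType} (a tau t : R) (mu : probability R R) x :
  0 < a -> 0 < tau -> class_G a tau mu -> 2 <= t -> t <= x ->
  (mu [set y : R | (x < `|y|)%R] <=
    (2 * expR (- ((t / tau) `^ a / 2)) * exp_const a tau * x `^ (- 6))%:E)%E.
Proof.
move=> a0 tau0 [_ [_ htail]] t2 tx.
have x2 := le_trans t2 tx; have x0 : 0 < x by apply: lt_le_trans x2.
have t0 : 0 < t by apply: lt_le_trans t2.
apply: (le_trans (htail x x2)); rewrite lee_fin -!mulrA ler_wpM2l //.
set y := (x / tau) `^ a.
have y0 : 0 < y by rewrite powR_gt0 // divr_gt0.
have -> : - y = - (y / 2) + - (y / 2) by field.
rewrite expRD; apply: ler_pM; rewrite ?expR_ge0 //.
  rewrite ler_expR lerN2 ler_wpM2r ?invr_ge0 // ge0_ler_powR ?nnegrE ?(ltW a0) //.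
  - by rewrite divr_ge0 // ltW.
  - by rewrite divr_ge0 // ltW.
  - by rewrite ler_wpM2r // invr_ge0 ltW.
apply: le_trans (expRN_half_le_powR (divr_gt0 (ltr0n _ 6) a0) y0) _.
rewrite /exp_const ler_wpM2l ?powR_ge0 // /y -powRrM.
have -> : a * - (6 / a) = - 6 by field; rewrite gt_eqF.
rewrite powRM ?invr_ge0 ?(ltW x0) ?(ltW tau0) // powR_inv_neg ?(ltW tau0) // opprK.
by rewrite mulrC.
Qed.

Definition log_const {R : realType} (a : R) : R := (1 + 4 / a) `^ (2 / a).

Lemma log_const_ge1 {R : realType} (a : R) : 0 < a -> 1 <= log_const a.
Proof.
move=> a0; rewrite -(powRr0 (1 + 4 / a)) ler_powR ?divr_ge0 ?(ltW a0) //.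
by rewrite lerDl divr_ge0 // ltW.
Qed.

(** From 1 + ln y <= (1 + 4/a)(1 + (a/4) ln y) <= (1 + 4/a) y^(a/4), raised to the power 2/a. *)
Lemma log_powR_le {R : realType} (a y : R) : 0 < a -> 1 <= y ->
  (1 + ln y) `^ (2 / a) <= log_const a * Num.sqrt y.
Proof.
move=> a0 y1; have y0 : 0 < y by apply: lt_le_trans y1.
have l0 := ln_ge0 y1.
have da : 0 <= 4 / a by rewrite divr_ge0 // ltW.
have h : 1 + ln y <= (1 + 4 / a) * expR (a / 4 * ln y).
  apply: (@le_trans _ _ ((1 + 4 / a) * (1 + a / 4 * ln y))).
    have -> : (1 + 4 / a) * (1 + a / 4 * ln y) = 1 + ln y + (4 / a + a / 4 * ln y).
      by field; rewrite gt_eqF.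
    by rewrite lerDl addr_ge0 // mulr_ge0 // divr_ge0 // ltW.
  by rewrite ler_wpM2l ?expR_ge1Dx // addr_ge0.
apply: (@le_trans _ _ (((1 + 4 / a) * expR (a / 4 * ln y)) `^ (2 / a))).
  rewrite ge0_ler_powR ?nnegrE ?divr_ge0 ?(ltW a0) ?addr_ge0 //.
  by rewrite mulr_ge0 ?expR_ge0 ?addr_ge0.
rewrite powRM ?expR_ge0 ?addr_ge0 // ler_wpM2l ?powR_ge0 //.
rewrite -powR12_sqrt ?(ltW y0) // /powR gt_eqF ?expR_gt0 // expRK gt_eqF //.
rewrite ler_expR le_eqVlt; apply/orP; left; apply/eqP.
by field; rewrite gt_eqF.
Qed.

Lemma log_level_ge1 {R : realType} (d j : nat) : (0 < j <= d)%N ->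
  1 <= ln (expR 1 * d%:R / j%:R) :> R.
Proof.
move=> jd; have y1 := @ratio_ge1 R d j jd.
rewrite -mulrA lnM ?posrE ?expR_gt0 ?(lt_le_trans ltr01 y1) // expRK lerDl.
exact: ln_ge0.
Qed.

Lemma log_level_gt0 {R : realType} (d j : nat) : (0 < j <= d)%N ->
  0 < expR 1 * d%:R / j%:R :> R.
Proof.
by move=> jd; rewrite -mulrA mulr_gt0 ?expR_gt0 // (lt_le_trans ltr01 (@ratio_ge1 R d j jd)).
Qed.

(** With y = k/j, the logarithm at [j] is L + ln y <= L (1 + ln y), since the logarithm [L] at [k]
    is at least 1. *)
Lemma log_weights_regular {R : realType} (c a : R) (d j k : nat) :
  0 < a -> (0 < j)%N -> (j <= k <= d)%N ->
  (c * (ln (expR 1 * d%:R / j%:R)) `^ a^-1) ^+ 2 <=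
  log_const a * (c * (ln (expR 1 * d%:R / k%:R)) `^ a^-1) ^+ 2 * Num.sqrt (k%:R / j%:R).
Proof.
move=> a0 j0 /andP[jk kd].
have k0 : (0 < k)%N by apply: leq_trans jk.
have kj1 : 1 <= k%:R / j%:R :> R by apply: ratio_ge1; rewrite j0.
have Lk1 : 1 <= ln (expR 1 * d%:R / k%:R) :> R by apply: log_level_ge1; rewrite k0.
have Lk0 : 0 < expR 1 * d%:R / k%:R :> R by apply: log_level_gt0; rewrite k0.
have -> : expR 1 * d%:R / j%:R = (expR 1 * d%:R / k%:R) * (k%:R / j%:R) :> R.
  by rewrite mulrA divfK // pnatr_eq0 -lt0n.
have sq (x : R) : (c * x `^ a^-1) ^+ 2 = c ^+ 2 * x `^ (2 / a).
  by rewrite exprMn -(powR_mulrn 2 (powR_ge0 _ _)) -powRrM [a^-1 * _]mulrC.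
rewrite !sq [leRHS]mulrAC [leRHS]mulrCA; apply: ler_wpM2l; first exact: sqr_ge0.
rewrite lnM ?posrE ?(lt_le_trans ltr01 kj1) //.
set L := ln (expR 1 * _ / _) in Lk1 *; set y := k%:R / _ in kj1 *.
have l0 := ln_ge0 kj1.
have L0 : 0 <= L by apply: le_trans Lk1.
apply: (@le_trans _ _ ((L * (1 + ln y)) `^ (2 / a))).
  rewrite ge0_ler_powR ?nnegrE ?divr_ge0 ?(ltW a0) ?addr_ge0 ?mulr_ge0 ?addr_ge0 //.
  by rewrite mulrDr mulr1 lerD2l ler_peMl.
rewrite powRM ?addr_ge0 // mulrC ler_wpM2r ?powR_ge0 //.
exact: log_powR_le.
Qed.

(** The constant [c] ensures t >= 2 and (t/tau)^a >= K L, where e^L = e d/r. The 2 in K = 2 + 48 M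
    cancels e^L, which leaves 12 M exp(-24 M L) <= 12 M exp(-24 M) <= 1/2, by u e^-u <= 1. *)
Lemma log_excess {R : realType} (a tau c : R) (mu : probability R R) (d r : nat) :
  0 < a -> 0 < tau ->
  c = 16 * log_const a * (2 + tau * (2 + 48 * exp_const a tau) `^ a^-1) ->
  class_G a tau mu -> (0 < r <= d)%N ->
  exists g, [/\ 0 <= g, expR 1 * d%:R * g <= r%:R / 2 &
    Ebound mu (excess (c * (ln (expR 1 * d%:R / r%:R)) `^ a^-1 / (16 * log_const a))) g].
Proof.
move=> a0 tau0 cE hmu rd.
have C1 := log_const_ge1 a0; have C0 : 0 < log_const a by apply: lt_le_trans C1.
set M := exp_const a tau; have M0 : 0 <= M by rewrite mulr_ge0 ?powR_ge0.
set K := 2 + 48 * M; have K2 : 2 <= K by rewrite lerDl mulr_ge0.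
have r0 : 0 < r%:R :> R by rewrite ltr0n; case/andP: rd.
have L1 := @log_level_ge1 R d r rd; have y0 := @log_level_gt0 R d r rd.
set L := ln _ in L1 *.
have L0 : 0 <= L by apply: le_trans L1.
have la1 : 1 <= L `^ a^-1 by rewrite -(powRr0 L) ler_powR // invr_ge0 ltW.
set t := _ / (16 * log_const a).
have tE : t = (2 + tau * K `^ a^-1) * L `^ a^-1.
  by rewrite /t cE; field; rewrite gt_eqF.
have tK : tau * K `^ a^-1 * L `^ a^-1 <= t.
  by rewrite tE ler_wpM2r ?powR_ge0 // lerDr.
have t2 : 2 <= t.
  rewrite tE -[leLHS]mulr1 ler_pM // lerDl mulr_ge0 ?powR_ge0 // ltW //.
have t0 : 0 < t by apply: lt_le_trans t2.
clearbody t.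
have kL : K * L <= (t / tau) `^ a.
  have -> : K * L = ((K * L) `^ a^-1) `^ a.
    by rewrite -powRrM mulVf ?gt_eqF // powRr1 // mulr_ge0 // (le_trans _ K2).
  rewrite ge0_ler_powR ?nnegrE ?(ltW a0) ?powR_ge0 ?divr_ge0 ?(ltW t0) ?(ltW tau0) //.
  rewrite powRM // ?(le_trans _ K2) // ler_pdivlMr // mulrC mulrA //.
set D := 2 * expR (- ((t / tau) `^ a / 2)) * M.
have D0 : 0 <= D by apply: mulr_ge0 => //; rewrite mulr_ge0 ?expR_ge0.
exists (6 * (D * t `^ (- 6))); split; last first.
- apply: Ebound_excess_tail => //; first by rewrite ler_nat.
  by move=> x tx; apply: class_G_tail.
- have h1 : 6 * (D * t `^ (- 6)) <= 6 * D.
    rewrite ler_wpM2l // ler_piMr //.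
    by rewrite -[leRHS](powRr0 t) ler_powR ?oppr_le0 // (le_trans _ t2) // ler1n.
  have h2 : 6 * D <= 12 * M * expR (- (K * L / 2)).
    have : expR (- ((t / tau) `^ a / 2)) <= expR (- (K * L / 2)).
      by rewrite ler_expR lerN2 ler_wpM2r ?invr_ge0.
    move/(ler_wpM2l M0); rewrite /D; lra.
  have -> : expR 1 * d%:R * (6 * (D * t `^ (- 6))) =
     r%:R * ((expR 1 * d%:R / r%:R) * (6 * (D * t `^ (- 6)))).
    by field; rewrite gt_eqF.
  rewrite ler_wpM2l ?(ltW r0) //.
  apply: (@le_trans _ _ (expR L * (12 * M * expR (- (K * L / 2))))).
    rewrite /L lnK ?posrE // ler_wpM2l ?(ltW y0) //.
    exact: le_trans h2.
  rewrite mulrCA -expRD.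
  apply: (@le_trans _ _ (12 * M * expR (- (24 * M)))).
    apply: ler_wpM2l; first exact: mulr_ge0.
    rewrite ler_expR /K.
    have : 0 <= M * (L - 1) by rewrite mulr_ge0 ?subr_ge0.
    by lra.
  have : 24 * M * expR (- (24 * M)) <= 1.
    rewrite expRN ler_pdivrMr ?expR_gt0 // mul1r.
    by apply: le_trans (expR_ge1Dx _); rewrite lerDr.
  by lra.
- by rewrite !mulr_ge0 ?powR_ge0.
Qed.

Lemma risk_bound_class_G (R : realType) (a tau : R) : 0 < a -> 0 < tau ->
   exists c C gam : R, 0 < c /\ 0 < C /\ 0 < gam /\ gam <= 2^-1 /\
   forall s d : nat, (1 <= s)%N -> (4 * s < nblocks gam d)%N ->
   let lam := fun j : nat => c * (ln (expR 1 * d%:R / j%:R)) `^ a^-1 in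
   forall B : 'I_(nblocks gam d) -> {set 'I_d}, is_block_partition B ->
   forall thetahat : ('I_d -> R) -> ('I_d -> R),
     (forall y, is_sorted_l1_est lam (mom_sigma B y) y (thetahat y)) ->
   forall (d0 : measure_display) (Omega : measurableType d0)
          (P : probability Omega R) (mu : probability R R) (xi : 'I_d -> Omega -> R),
     class_G a tau mu -> iid_with P xi mu ->
   forall sigma : R, 0 < sigma ->
   forall theta : 'I_d -> R, in_Theta s theta ->
     (\int[P]_w (`| sigma_hat2 (obs theta sigma xi w) (thetahat (obs theta sigma xi w))
                   - sigma ^+ 2 |)%:E
      <= (C * sigma ^+ 2 * Num.max (Num.sqrt d%:R)^-1
             (s%:R / d%:R * (ln (expR 1 * d%:R / s%:R)) `^ (2 / a)))%:E)%E.
Proof.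
move=> a0 tau0.
have C1 := log_const_ge1 a0; have C0 : 0 < log_const a by apply: lt_le_trans C1.
have M0 : 0 <= exp_const a tau by rewrite mulr_ge0 ?powR_ge0.
pose kap := fourth_bound (2 * exp_const a tau) 6.
have k1 : 1 <= kap by apply: fourth_bound_ge1; [exact: mulr_ge0|rewrite ltr_nat].
have k0 : 0 < kap by apply: lt_le_trans k1.
pose c := 16 * log_const a * (2 + tau * (2 + 48 * exp_const a tau) `^ a^-1).
have c1 : 1 <= c.
  apply: mulr_ege1; first by lra.
  have : 0 <= tau * (2 + 48 * exp_const a tau) `^ a^-1 by rewrite mulr_ge0 ?powR_ge0 // ltW.
  by lra.
have c0 : 0 < c by apply: lt_le_trans c1.
exists c, ((130 * kap + 18 * log_const a) * c ^+ 2), ((128 * kap)^-1); do 4?split => //.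
- by rewrite mulr_gt0 ?exprn_gt0 //; lra.
- by rewrite invr_gt0 mulr_gt0.
- by rewrite lef_pV2 ?posrE ?mulr_gt0 //; lra.
move=> s d s0 sm lam B partB thetahat est d0 Omega P mu xi hmu iid sigma sigma0 theta sth.
have [_ [h2 _]] := hmu.
apply: (@risk_bound_nblocks _ _ _ P mu kap (log_const a) c sigma _ d s lam _ B thetahat xi theta) => //.
- apply: Ebound_fourth_tail; [exact: mulr_ge0|by rewrite ltr_nat|].
  (* With the level frozen at 2 the exponential half is bounded by 1, which gives the coefficient 2
     [exp_const] in [kap]. *)
  move=> x x2; apply: (le_trans (class_G_tail a0 tau0 hmu (lexx 2) x2)).
  rewrite lee_fin ler_wpM2r ?powR_ge0 // ler_wpM2r // ler_piMr //.
  by rewrite expR_le1 oppr_le0 divr_ge0 ?powR_ge0.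
- move=> i hi; rewrite mulr_gt0 // powR_gt0 //.
  exact: lt_le_trans (log_level_ge1 hi).
- move=> i j i0 /andP[ij jd]; rewrite ler_wpM2l ?(ltW c0) //.
  have hj : (0 < j <= d)%N by rewrite jd (leq_trans i0 ij).
  have hi : (0 < i <= d)%N by rewrite i0 (leq_trans ij jd).
  rewrite ge0_ler_powR ?nnegrE ?invr_ge0 ?(ltW a0) ?(le_trans ler01 (log_level_ge1 _)) //.
  rewrite ler_ln ?posrE ?log_level_gt0 // ler_wpM2l ?mulr_ge0 ?expR_ge0 //.
  by rewrite lef_pV2 ?posrE ?ltr0n ?ler_nat // (leq_trans i0).
- by move=> j k; exact: log_weights_regular.
- by move=> r; exact: (log_excess a0 tau0 erefl hmu).
- move=> sd; have -> : lam s ^+ 2 = c ^+ 2 * (ln (expR 1 * d%:R / s%:R)) `^ (2 / a).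
    by rewrite exprMn -(powR_mulrn 2 (powR_ge0 _ _)) -powRrM [a^-1 * _]mulrC.
  by ring.
Qed.

Theorem theorem7 :
  (forall (R : realType) (a tau : R), 0 < a -> 0 < tau ->
   exists c C gam : R, 0 < c /\ 0 < C /\ 0 < gam /\ gam <= 2^-1 /\
   forall s d : nat, (1 <= s)%N -> (4 * s < nblocks gam d)%N ->
   let lam := fun j : nat => c * (ln (expR 1 * d%:R / j%:R)) `^ a^-1 in
   forall B : 'I_(nblocks gam d) -> {set 'I_d}, is_block_partition B ->
   forall thetahat : ('I_d -> R) -> ('I_d -> R),
     (forall y, is_sorted_l1_est lam (mom_sigma B y) y (thetahat y)) ->
   forall (d0 : measure_display) (Omega : measurableType d0)
          (P : probability Omega R) (mu : probability R R) (xi : 'I_d -> Omega -> R),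
     class_G a tau mu -> iid_with P xi mu ->
   forall sigma : R, 0 < sigma ->
   forall theta : 'I_d -> R, in_Theta s theta ->
     (\int[P]_w (`| sigma_hat2 (obs theta sigma xi w) (thetahat (obs theta sigma xi w))
                   - sigma ^+ 2 |)%:E
      <= (C * sigma ^+ 2 * Num.max (Num.sqrt d%:R)^-1
             (s%:R / d%:R * (ln (expR 1 * d%:R / s%:R)) `^ (2 / a)))%:E)%E)
  /\
  (forall (R : realType) (a tau : R), 4 < a -> 0 < tau ->
   exists c C gam : R, 0 < c /\ 0 < C /\ 0 < gam /\ gam <= 2^-1 /\
   forall s d : nat, (1 <= s)%N -> (4 * s < nblocks gam d)%N ->
   let lam := fun j : nat => c * (d%:R / j%:R) `^ a^-1 in
   forall B : 'I_(nblocks gam d) -> {set 'I_d}, is_block_partition B ->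
   forall thetahat : ('I_d -> R) -> ('I_d -> R),
     (forall y, is_sorted_l1_est lam (mom_sigma B y) y (thetahat y)) ->
   forall (d0 : measure_display) (Omega : measurableType d0)
          (P : probability Omega R) (mu : probability R R) (xi : 'I_d -> Omega -> R),
     class_P a tau mu -> iid_with P xi mu ->
   forall sigma : R, 0 < sigma ->
   forall theta : 'I_d -> R, in_Theta s theta ->
     (\int[P]_w (`| sigma_hat2 (obs theta sigma xi w) (thetahat (obs theta sigma xi w))
                   - sigma ^+ 2 |)%:E
      <= (C * sigma ^+ 2 * Num.max (Num.sqrt d%:R)^-1
             ((s%:R / d%:R) `^ (1 - 2 / a)))%:E)%E).
Proof.
by split; [exact: risk_bound_class_G|exact: risk_bound_class_P].
Qed.
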